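(* Let $a>0$, $T>0$, $K=[-a,a]$, and let $f:[0,T]\times\mathbb R\to\mathbb R$ be a Carathéodory function with $|f(t,x)|\le m(t)$ for all $(t,x)\in[0,T]\times\mathbb R$, where $m\in L^1([0,T])$, and such that for some $\alpha\in L^1([0,T])$ one has $|f(t,x)-f(t,y)|\le\alpha(t)|x-y|$ for a.e. $t\in[0,T]$ and all $x,y\in\mathbb R$. Then there exist infinitely many solutions of the impulsive Dirichlet problem $$\ddot x(t)=f(t,x(t))\ \text{ for a.e. } t\in[0,T],\ |x(t)|<a;\qquad \dot x(s+)=-\dot x(s)\ \text{ if } |x(s)|=a;\qquad x(0)=x(T)=0.$$
   Context: Carathéodory means: $f(\cdot,x)$ is measurable for every $x$ and $f(t,\cdot)$ is continuous for a.e. $t\in[0,T]$. A solution is a continuous function $x:[0,T]\to[-a,a]$ which has an absolutely continuous derivative on intervals where $|x(t)|<a$, satisfies $\ddot x(t)=f(t,x(t))$ for a.e. $t$ with $|x(t)|<a$, satisfies the impulse condition $\dot x(s+)=-\dot x(s)$ at every time $s$ with $|x(s)|=a$ (here $\dot x(s)$ is the velocity just before the impact, i.e. the left-hand one, and $\dot x(s+)$ the right-hand one), and satisfies $x(0)=x(T)=0$. *)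

(* Defs.v *)
From HB Require Import structures.
From mathcomp Require Import all_boot all_order all_algebra.
From mathcomp Require Import all_classical all_reals all_analysis.

Set Implicit Arguments.
Unset Strict Implicit.
Unset Printing Implicit Defensive.

Import Order.TTheory GRing.Theory Num.Theory.
Import numFieldNormedType.Exports.

Local Open Scope classical_set_scope.
Local Open Scope ring_scope.

(* The real line with its Lebesgue (not merely Borel) sigma-algebra, i.e. the
   domain of [completed_lebesgue_measure]. *)
Notation lebesgueTypeR R :=
  (caratheodory_type ((wlength (R := R) idfun)^*)%mu) (only parsing).

(* Functions on [0, T] are represented by functions on R whose values outside
   [0, T] are irrelevant. *)
Definition caratheodory_fun (R : realType) (T : R) (f : R -> R -> R) : Prop :=
  (forall x : R, measurable_fun (`[0, T]%classic : set (lebesgueTypeR R))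
               (fun t : lebesgueTypeR R => f t x)) /\
  {ae @completed_lebesgue_measure R, forall t : R, 0 <= t <= T -> continuous (f t)}.

Definition L1 (R : realType) (T : R) (g : R -> R) : Prop :=
  (@completed_lebesgue_measure R).-integrable `[0, T] (EFin \o g).

Definition absolutely_continuous_on (R : realType) (I : set R) (v : R -> R) :
    Prop :=
  forall e : R, 0 < e -> exists2 d, 0 < d &
    forall (n : nat) (p q : 'I_n -> R),
      (forall i, [/\ I (p i), I (q i) & p i <= q i]) ->
      trivIset setT (fun i => `]p i, q i[%classic) ->
      \sum_(i < n) (q i - p i) < d ->
      \sum_(i < n) `|v (q i) - v (p i)| < e.

Definition diff_quotient (R : realType) (x : R -> R) (t s : R) : R :=
  (x s - x t) / (s - t).

(* The derivative is relative to I, hence one-sided at endpoints of I that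
   belong to I. *)
Definition has_derivative_on (R : realType) (I : set R) (x v : R -> R) : Prop :=
  forall t : R, I t -> diff_quotient x t s @[s --> within I t^'] --> v t.

Definition left_velocity (R : realType) (x : R -> R) (s v : R) : Prop :=
  diff_quotient x s r @[r --> s^'-] --> v.

Definition right_velocity (R : realType) (x : R -> R) (s v : R) : Prop :=
  diff_quotient x s r @[r --> s^'+] --> v.

(* In [sol_ode], the two-sided second derivative only makes sense at interior
   times, but the endpoints 0 and T form a null set.  In [sol_impulse], s is
   automatically interior, by [sol_bc0] and [sol_bcT], when a > 0. *)
Record impulsive_solution (R : realType) (a T : R) (f : R -> R -> R)
    (x : R -> R) : Prop := {
  sol_continuous : {within `[0, T], continuous x};
  sol_range : forall t : R, 0 <= t <= T -> - a <= x t <= a;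
  sol_AC : forall I : set R, is_interval I -> I `<=` `[0, T] ->
    (forall t : R, I t -> `|x t| < a) ->
    exists v : R -> R, absolutely_continuous_on I v /\ has_derivative_on I x v;
  sol_ode : {ae @completed_lebesgue_measure R, forall t : R, 0 <= t <= T -> `|x t| < a ->
    is_derive t 1 x^`()%classic (f t (x t))};
  sol_impulse : forall s : R, 0 <= s <= T -> `|x s| = a ->
    exists v : R, left_velocity x s v /\ right_velocity x s (- v);
  sol_bc0 : x 0 = 0;
  sol_bcT : x T = 0 }.

(* Main.v *)
Require Import Defs.
From mathcomp Require Import all_boot all_order all_algebra.
From mathcomp Require Import all_classical all_reals all_analysis.
From mathcomp Require Import measurable_realfun lebesgue_measure ring lra.
Import Order.TTheory GRing.Theory Num.Theory.
Import numFieldNormedType.Exports.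
Local Open Scope classical_set_scope.
Local Open Scope ring_scope.

Set Implicit Arguments.
Unset Strict Implicit.
Unset Printing Implicit Defensive.

(** A motion that bounces between the walls [-a] and [a] is the folded image of
a motion that passes through them. Let [fold] be the triangle wave that folds the
line onto the strip, with walls at the odd multiples of [a]. Reversing the
velocity at an impact amounts to moving on into a mirror image of the strip, so
if [y] solves [y'' = s(y) f(t, fold y)], where [s(y)] is the slope of [fold] at
[y], that is [1] or [-1], and crosses the walls at a nonzero velocity, then
[x = fold y] is an impulsive solution. Moreover [x(0) = x(T) = 0] when [y(0) = 0] and
[y(T)] is an even multiple [2 k a]. The force is bounded by [m], so the velocity
of such a [y] stays within twice [mass], the integral of [m], of its mean
[2 k a / T]. For large [k] this velocity is positive: [y] meets each wall at most
once and the jumps of [s] are invisible to the integral equation. As [k] grows the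
initial velocities are unbounded, whence infinitely many solutions.

The two-point problem for [y] is solved by approximation. The slope [s] is
replaced by a difference quotient of [fold], which is continuous and bounded by
[1], and the position that enters the force is delayed by [T / (n + 1)]. A
delayed equation is solved by finitely many explicit integrations; the solution
depends continuously on the initial velocity [c] and its value at [T] differs
from [c T] by at most [mass * T], so the intermediate value theorem reaches any
prescribed value at [T] ([tonelli_bvp]). These approximations are Lipschitz with
a common constant, hence a subsequence converges ([lipschitz_subsequence]). The
limit increases at a positive rate, hence is on each wall at most once, and
dominated convergence gives its integral equation ([folded_bvp]). Folding it
back yields a solution ([folded_solution]).

The functions [f(., x)] are only Lebesgue measurable. Off a null set, [f] agrees
with a function that is Borel in [t] and continuous in [x] for every [t]
([caratheodory_borel]), so the whole argument takes place on the Borel line. *)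

(** * Borel representatives of Lebesgue measurable objects *)

Section BorelRepresentative.
Context {R : realType}.
Local Notation mu := (@lebesgue_measure R).
Local Notation cmu := (@completed_lebesgue_measure R).

(** The Caratheodory sigma-algebra of the line is the completion of the Borel
one. *)
Lemma lebesgue_measurable_ae_borel (A : set (lebesgueTypeR R)) :
  measurable A -> exists2 B : set (measurableTypeR R), measurable B &
    mu.-negligible [set x | ~ (A x <-> B x)].
Proof.
move=> mA; have : (completed_algebra_gen mu).-sigma.-measurable A.
  by rewrite completed_caratheodory_measurable.
rewrite g_sigma_completed_algebra_genE => -[B mB [N negN AE]].
exists B => //; apply: negligibleS negN => x /= nAB.
apply: contrapT => nN; apply: nAB; rewrite -AE; split; [by case|by left].
Qed.

Lemma completed_negligible (N : set R) :
  cmu.-negligible N -> mu.-negligible N.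
Proof.
move=> [A [mA A0 NA]].
have [B mB nAB] := lebesgue_measurable_ae_borel mA.
have [C [mC C0 sC]] := nAB.
have B0 : mu (B `\` C) = 0%E.
  apply/eqP; rewrite -measure_le0; rewrite -[leRHS]A0.
  apply: le_outer_measure => x [Bx nCx]; apply: contrapT => nAx.
  by apply: nCx; apply: sC => /= -[_ /(_ Bx)].
have : mu.-negligible (C `|` (B `\` C)).
  apply: negligibleU; first by exists C; split.
  by exists (B `\` C); split => //; exact: measurableD.
apply: negligibleS => x /NA Ax; have [Cx|nCx] := pselect (C x); first by left.
right; split => //; apply: contrapT => nBx; apply: nCx; apply: sC => /=.
by case=> /(_ Ax).
Qed.

Lemma completed_ae (P : R -> Prop) :
  {ae mu, forall t, P t} -> {ae cmu, forall t, P t}.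
Proof.
move=> [N [mN N0 sN]]; exists N; split => //; exact: sub_caratheodory.
Qed.

(** Each rational superlevel set of [h] is Borel up to a null set; [N] collects
these countably many null sets. The conclusion covers every Borel set above [N],
so that one exceptional set can serve several functions at once. *)
Lemma lebesgue_measurable_fun_ae_borel (h : R -> R) :
  measurable_fun (setT : set (lebesgueTypeR R)) h ->
  exists N : set (measurableTypeR R), [/\ measurable N, mu N = 0%E &
    forall N' : set (measurableTypeR R), measurable N' -> N `<=` N' ->
    measurable_fun (setT : set (measurableTypeR R)) (h \_ (~` N') : R -> R)].
Proof.
move=> mh.
have H (q : rat) : exists2 B : set (measurableTypeR R), measurable B &
    mu.-negligible [set x | ~ (ratr q < h x <-> B x)].
  have mq : measurable ([set x | ratr q < h x] : set (lebesgueTypeR R)).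
    rewrite -[X in measurable X]setTI.
    rewrite (_ : [set x | _] = h @^-1` `]ratr q, +oo[); first exact: mh.
    by apply/seteqP; split => x; rewrite /= in_itv /= andbT.
  exact: (lebesgue_measurable_ae_borel mq).
pose B q := sval (cid2 (H q)).
have mB q : measurable (B q) by rewrite /B; case: cid2.
pose D q := [set x | ~ (ratr q < h x <-> B q x)].
have nD q : mu.-negligible (D q) by rewrite /D /B; case: cid2.
have : mu.-negligible (\bigcup_k (if unpickle k is Some q then D q else set0)).
  apply: negligible_bigcup => k; case: unpickle => [q|] //.
  exact: negligible_set0.
move=> [N [mN N0 sN]]; exists N; split => // N' mN' NN'.
have hB q x : ~ N' x -> (ratr q < h x <-> B q x).
  move=> nN'x; apply: contrapT => nE; apply: nN'x; apply: NN'; apply: sN.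
  by exists (pickle q); [exact: I|rewrite pickleK; exact: nE].
have mCN' : measurable (~` N') by exact: measurableC.
apply/(measurable_restrictT h mCN').
move=> _; apply: (measurability _ (RGenOInfty.measurableE R)) => //.
move=> _ [_ [r ->] <-].
rewrite [X in measurable X](_ : _ = ~` N' `&`
    \bigcup_q (if unpickle q is Some q then
       if r < ratr q then B q else set0 else set0)).
  apply: measurableI; first exact: measurableC.
  apply: bigcupT_measurable => k; case: unpickle => [q|]; last exact: measurable0.
  by case: ifP => _; [exact: mB|exact: measurable0].
apply/seteqP; split => x [nx].
  rewrite /= in_itv /= andbT => /rat_in_itvoo[q].
  rewrite in_itv /= => /andP[rq qh]; split => //.
  by exists (pickle q); [exact: I|rewrite pickleK rq; apply/hB].
move=> [k _]; case: unpickle => // q; case: ifPn => // rq Bx.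
by split => //; rewrite /= in_itv /= andbT (lt_trans rq) //; apply/hB.
Qed.

(** On the Borel sets the completed measure is the Lebesgue measure, so the
latter is the image of the former under the identity from the completed line to
the Borel line. *)
Lemma completed_integrable (h h' : R -> R) (D : set (measurableTypeR R)) :
  measurable D ->
  measurable_fun D h' -> (forall x, D x -> `|h' x| <= `|h x|) ->
  cmu.-integrable D (EFin \o h) -> mu.-integrable D (EFin \o h').
Proof.
move=> mD mh' hh /integrableP[mh fin].
have cmid : measurable_fun [set: lebesgueTypeR R]
    (idfun : lebesgueTypeR R -> measurableTypeR R).
  by move=> _ Y mY; rewrite setTI; apply: sub_caratheodory.
apply/integrableP; split; first exact/measurable_EFinP.
rewrite (@eq_measure_integral _ _ _ _ (pushforward cmu
  (idfun : lebesgueTypeR R -> measurableTypeR R))) //.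
have mc' : measurable_fun D (fun x => `|(h' x)%:E|%E).
  by apply: measurableT_comp => //; exact/measurable_EFinP.
rewrite (ge0_integral_pushforward cmid cmu mD mc'); last first.
  by move=> y _; exact: abse_ge0.
have mcc : measurable_fun (D : set (lebesgueTypeR R)) (fun x => `|(h' x)%:E|%E).
  by move=> _ Y mY; apply: sub_caratheodory; exact: mc'.
apply: le_lt_trans fin.
have mcD : measurable (D : set (lebesgueTypeR R)) by exact: sub_caratheodory.
apply: (@ge0_le_integral _ (lebesgueTypeR R) R cmu D mcD
  (fun x => `|(h' x)%:E|%E) (fun x => `|(h x)%:E|%E)).
- by move=> x _; exact: abse_ge0.
- exact: mcc.
- by apply: measurableT_comp => //; exact: mh.
- by move=> x Dx; rewrite /= lee_fin hh.
Qed.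

End BorelRepresentative.

Section BorelCaratheodory.
Context {R : realType}.
Local Notation mu := (@lebesgue_measure R).
Local Notation cmu := (@completed_lebesgue_measure R).

Lemma exists_rat_cvg (x : R) :
  exists q : nat -> rat, (fun n => ratr (q n) : R) @ \oo --> x.
Proof.
have /choice[q qP] : forall n : nat, exists q : rat,
    x < ratr q < x + n.+1%:R^-1.
  move=> n; have /rat_in_itvoo[q] : x < x + n.+1%:R^-1.
    by rewrite ltrDl invr_gt0.
  by rewrite in_itv; exists q.
exists q; apply: (@squeeze_cvgr _ _ _ _ (fun=> x) (fun n => x + n.+1%:R^-1)).
- by near=> n; have /andP[/ltW -> /ltW ->] := qP n.
- exact: cvg_cst.
- rewrite -[X in _ --> X]addr0; apply: cvgD; first exact: cvg_cst.
  exact: cvg_harmonic.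
Unshelve. all: by end_near. Qed.

(** For rational [x] the functions [f(., x)] have Borel representatives off a
common null set. Outside it, continuity in [x] makes every [f(., x)] a limit of
those; on it, and outside [[0, T]], [g] is set to zero. *)
Lemma caratheodory_borel (T : R) (f : R -> R -> R) (m : R -> R) :
  caratheodory_fun T f -> L1 T m ->
  (forall t x, 0 <= t <= T -> `|f t x| <= m t) ->
  exists (g : R -> R -> R) (m' : R -> R),
  [/\ forall x, measurable_fun (setT : set (measurableTypeR R)) (g ^~ x),
      forall t, continuous (g t),
      forall t x, `|g t x| <= m' t,
      mu.-integrable (setT : set (measurableTypeR R)) (EFin \o m') &
      {ae mu, forall t, 0 <= t <= T -> forall x, g t x = f t x}].
Proof.
move=> [mf /completed_negligible [Nc [mNc Nc0 cf]]] Lm fm.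
have mI : measurable (`[0, T]%classic : set (measurableTypeR R)).
  exact: measurable_itv.
have mIc : measurable (`[0, T]%classic : set (lebesgueTypeR R)).
  exact: sub_caratheodory.
have mrestr (h : R -> R) :
    measurable_fun (`[0, T]%classic : set (lebesgueTypeR R)) h ->
    measurable_fun (setT : set (lebesgueTypeR R)) (h \_ `[0, T] : R -> R).
  move=> mh.
  exact: (@measurable_restrictT _ _ (lebesgueTypeR R) (measurableTypeR R)
    `[0, T]%classic h mIc).1.
have Hq (q : rat) :=
  lebesgue_measurable_fun_ae_borel (mrestr (f ^~ (ratr q)) (mf (ratr q))).
have mm : measurable_fun (`[0, T]%classic : set (lebesgueTypeR R)) m.
  by apply/measurable_EFinP; exact: (measurable_int cmu).
have [Nm [mNm Nm0 Hm]] := lebesgue_measurable_fun_ae_borel (mrestr m mm).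
have : mu.-negligible (Nc `|` (Nm `|`
  \bigcup_k (if unpickle k is Some q then sval (cid (Hq q)) else set0))).
  apply: negligibleU.
    by exists Nc; split.
  apply: negligibleU; first by exists Nm; split.
  apply: negligible_bigcup => k; case: unpickle => [q|].
    by case: cid => /= N [mN N0 _]; exists N; split.
  exact: negligible_set0.
move=> [N [mN N0 sN]].
have mCN : measurable (~` N) by exact: measurableC.
pose E := `[0, T]%classic `&` ~` N.
have mE : measurable (E : set (measurableTypeR R)) by exact: measurableI.
have restrE (h : R -> R) : (h \_ `[0, T]) \_ (~` N) = h \_ E.
  by rewrite /E -patch_setI setIC.
have mgq (q : rat) : measurable_fun (setT : set (measurableTypeR R))
    ((f ^~ (ratr q)) \_ E).
  rewrite -restrE; have [_ _ HNq] := svalP (cid (Hq q)).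
  apply: (HNq _ mN) => x Nqx; apply: sN; right; right.
  by exists (pickle q); [exact: I|rewrite pickleK].
pose g (t x : R) : R := ((f ^~ x) \_ E) t.
pose m' : R -> R := m \_ E.
have cg t : continuous (g t).
  move=> x; rewrite /g; case: (asboolP (E t)) => Et.
    rewrite [X in continuous_at _ X](_ : _ = f t); last first.
      by apply/funext => y; rewrite patchE mem_set.
    move: x; apply: contrapT => nct; apply: Et.2; apply: sN; left.
    apply: cf => /= ct; apply: nct; apply: ct.
    by have := Et.1; rewrite /= in_itv.
  rewrite [X in continuous_at _ X](_ : _ = cst 0); last first.
    by apply/funext => y; rewrite patchE memNset.
  exact: cst_continuous.
have gm t x : `|g t x| <= m' t.
  rewrite /g /m' !patchE; case: ifPn => [/set_mem [tI _]|]; last by rewrite normr0.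
  by apply: fm; move: tI; rewrite /= in_itv.
have mg x : measurable_fun (setT : set (measurableTypeR R)) (g ^~ x).
  have [q qx] := exists_rat_cvg x.
  apply: (@measurable_fun_cvg _ _ _ _ (fun n => g ^~ (ratr (q n)))).
    by move=> n; exact: mgq.
  move=> t _.
  by apply: cvg_comp; [exact: qx|exact: cg].
have mm' : measurable_fun (setT : set (measurableTypeR R)) m'.
  rewrite /m' -restrE; apply: (Hm _ mN) => x Nmx.
  by apply: sN; right; left.
exists g, m'; split => //.
- have : mu.-integrable `[0, T] (EFin \o m').
    apply: (@completed_integrable _ m) => //; first exact: measurable_funTS.
    move=> t tI; rewrite /m' patchE; case: ifPn => // _.
    by rewrite normr0.
  move/(integrable_mkcond _ mI).1; congr (_.-integrable _ _).
  apply/funext => t; rewrite patchE; case: ifPn => // tI.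
  by rewrite /= /m' patchE memNset // => -[/mem_set]; rewrite (negbTE tI).
- exists N; split => // t /=; apply: contra_notP => nN tT x.
  by rewrite /g patchE mem_set //; split => //=; rewrite in_itv.
Qed.

End BorelCaratheodory.

(** * Folding the line onto the strip *)

Section Fold.
Context {R : realType} (a : R).
Hypothesis a_gt0 : 0 < a.

(** The walls bounding the branch [j] of the triangle wave are [wall j - 2 a]
and [wall j]. *)
Definition wall (j : nat) : R := (2 * j%:R + 1) * a.

(** Only the walls [0], ..., [k - 1] are folded: the half-line beyond the outermost
one is reflected back, then the remaining ones are folded. Each step is
[1]-Lipschitz, and this finite version agrees with the triangle wave on
[[- a, wall k]], where the motion takes place. *)
Fixpoint fold (k : nat) (z : R) : R :=
  if k is k'.+1 then fold k' (wall k' - `|z - wall k'|) else z.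

Lemma wallS j : wall j.+1 = wall j + 2 * a.
Proof. by rewrite /wall -natr1; ring. Qed.

Lemma fold_lipschitz k z w : `|fold k z - fold k w| <= `|z - w|.
Proof.
elim: k z w => [|k IH] z w //=; apply: (le_trans (IH _ _)).
rewrite (_ : _ - _ = `|w - wall k| - `|z - wall k|); last by ring.
apply: (le_trans (ler_dist_dist _ _)).
by rewrite distrC (_ : _ - _ = z - w) //; ring.
Qed.

Lemma fold_continuous k : continuous (fold k).
Proof.
move=> z; apply/cvgrPdist_lt => e e0; near=> w.
apply: (le_lt_trans (fold_lipschitz _ _ _)).
near: w; exact: cvgr_dist_lt.
Unshelve. all: by end_near. Qed.

Lemma fold_branch k j z : (j <= k)%N -> wall j - 2 * a <= z <= wall j ->
  fold k z = (-1) ^+ j * (z - 2 * j%:R * a).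
Proof.
elim: k j z => [|k IH] j z /=.
  by rewrite leqn0 => /eqP -> _; rewrite expr0; ring.
rewrite leq_eqVlt => /predU1P[->|]; last first.
  rewrite ltnS => jk zj; rewrite (IH j) //.
    rewrite ler0_norm; first by rewrite /wall; ring.
    have : wall j <= wall k.
      by rewrite /wall ler_pM2r // lerD2r ler_pM2l // ler_nat.
    lra.
  have : wall j <= wall k.
    by rewrite /wall ler_pM2r // lerD2r ler_pM2l // ler_nat.
  move=> jk'; rewrite ler0_norm; lra.
rewrite wallS => zk; rewrite ger0_norm; last lra.
rewrite (IH k) //; last lra.
by rewrite exprS -natr1 /wall; ring.
Qed.

Lemma exists_branch k z : - a <= z <= wall k ->
  exists2 j, (j <= k)%N & wall j - 2 * a <= z <= wall j.
Proof.
elim: k => [|k IH].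
  by move=> zk; exists 0%N => //; move: zk; rewrite /wall; have := a_gt0; lra.
move=> /andP[z0 zk]; have [zk'|zk'] := leP z (wall k).
  by have [|j jk jz] := IH; [rewrite z0|exists j => //; rewrite leqW].
by exists k.+1 => //; rewrite zk andbT wallS; (have := a_gt0; lra).
Qed.

Lemma fold_wall k j : (j <= k)%N -> fold k (wall j) = (-1) ^+ j * a.
Proof.
move=> jk; rewrite (fold_branch jk); last by rewrite lexx andbT gerBl mulr_ge0 // ltW.
by congr (_ * _); rewrite /wall; ring.
Qed.

Lemma fold_period k j : (j <= k)%N -> fold k (2 * j%:R * a) = 0.
Proof.
move=> jk; rewrite (fold_branch jk) ?subrr ?mulr0 // /wall; have := a_gt0; lra.
Qed.

Lemma norm_fold_le k z : - a <= z <= wall k -> `|fold k z| <= a.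
Proof.
move=> /exists_branch[j jk zj]; rewrite (fold_branch jk zj).
rewrite normrM normrX normrN1 expr1n mul1r ler_norml.
by move: zj; rewrite /wall; have := a_gt0; lra.
Qed.

Lemma norm_fold_lt k z : - a <= z <= wall k -> `|fold k z| < a ->
  exists2 j, (j <= k)%N & wall j - 2 * a < z < wall j.
Proof.
move=> /exists_branch[j jk zj]; rewrite (fold_branch jk zj).
rewrite normrM normrX normrN1 expr1n mul1r ltr_norml => h; exists j => //.
by move: h; rewrite /wall; have := a_gt0; lra.
Qed.

Lemma norm_fold_eq k z : - a < z < wall k -> `|fold k z| = a ->
  exists2 j, (j < k)%N & z = wall j.
Proof.
move=> zk; have /exists_branch[j jk zj] : - a <= z <= wall k by have := a_gt0; lra.
rewrite (fold_branch jk zj) normrM normrX normrN1 expr1n mul1r => h.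
have : z = wall j \/ z = wall j - 2 * a.
  move: h; rewrite /wall.
  by case: (ger0P (z - 2 * j%:R * a)) => ? ?; [left|right]; have := a_gt0; lra.
case=> zE.
  exists j => //; rewrite ltn_neqAle jk andbT; apply/eqP => jE.
  by move: zk; rewrite zE jE; have := a_gt0; lra.
case: j jk zj h zE => [|j] jk zj h zE.
  by move: zk; rewrite zE /wall; have := a_gt0; lra.
by exists j => //; rewrite zE wallS; ring.
Qed.

(** A continuous approximation of the derivative of [fold], which is [1] or [-1].
As a difference quotient of a [1]-Lipschitz function it is bounded by [1], so
that smoothing does not enlarge the bound on the force. *)
Definition fold_slope (k n : nat) (z : R) : R :=
  n.+1%:R * (fold k (z + n.+1%:R^-1) - fold k z).

Lemma norm_fold_slope_le k n z : `|fold_slope k n z| <= 1.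
Proof.
rewrite /fold_slope normrM ger0_norm //.
rewrite -[leRHS](@mulfV _ n.+1%:R) //; apply: ler_wpM2l => //.
apply: (le_trans (fold_lipschitz _ _ _)).
by rewrite addrAC subrr add0r ger0_norm.
Qed.

Lemma fold_slope_continuous k n : continuous (fold_slope k n).
Proof.
move=> z; apply: cvgM; first exact: cvg_cst.
apply: cvgB; last exact: fold_continuous.
apply: (@cvg_comp _ _ _ (fun z => z + n.+1%:R^-1) (fold k)); last exact: fold_continuous.
by apply: cvgD; [exact: cvg_id|exact: cvg_cst].
Qed.

(** For [n] large both points of the difference quotient lie in the same branch,
on which [fold] is affine. *)
Lemma fold_slope_cvg k j (e : nat -> nat) (w : nat -> R) (z : R) :
  (j <= k)%N -> wall j - 2 * a < z < wall j ->
  (forall n, (n <= e n)%N) -> w @ \oo --> z ->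
  (fun n => fold_slope k (e n) (w n)) @ \oo --> ((-1) ^+ j : R).
Proof.
move=> jk /andP[lz zr] he wz.
have d0 : 0 < (wall j - z) / 2 by lra.
apply: cvg_near_cst; near=> n.
have n1 : (e n).+1%:R^-1 <= n.+1%:R^-1 :> R.
  by rewrite lef_pV2 ?posrE // ler_nat ltnS.
have n2 : n.+1%:R^-1 < (wall j - z) / 2.
  by near: n; exact: near_infty_natSinv_lt (PosNum d0).
have n3 : w n < z + (wall j - z) / 2.
  by near: n; apply: (cvgr_lt z) => //; lra.
have n4 : wall j - 2 * a < w n by near: n; exact: (cvgr_gt z).
have n5 : 0 < (e n).+1%:R^-1 :> R by [].
have n0 : (e n).+1%:R != 0 :> R by [].
have {n1 n2} n1 := le_lt_trans n1 n2.
rewrite /fold_slope; move: n1 n5; set d := _^-1 => n1 n5.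
have n6 : w n + d < wall j by lra.
have n7 : w n < wall j by lra.
have n8 : wall j - 2 * a < w n + d by lra.
rewrite !(fold_branch jk) ?(ltW n4) ?(ltW n6) ?(ltW n7) ?(ltW n8) //.
rewrite -mulrBr mulrCA (_ : _ - _ = d); last by ring.
by rewrite mulfV ?mulr1.
Unshelve. all: by end_near. Qed.

End Fold.

(** * Second primitives of dominated functions *)

Section DoublePrimitive.
Context {R : realType} (T : R) (m : R -> R).
Local Notation Rm := (measurableTypeR R).
Local Notation mu := (@lebesgue_measure R).
Hypothesis m_int : mu.-integrable (setT : set Rm) (EFin \o m).

Definition dominated (u : R -> R) : Prop :=
  measurable_fun (setT : set Rm) u /\ forall s, `|u s| <= m s.

Definition mass : R := \int[mu]_(s in `[0, T]) m s.

Definition ramp (t s : R) : R := Num.max 0 (t - s).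

(** The solution of [v'' = u], [v(0) = v'(0) = 0], written with the kernel
[max(0, t - s)] over the fixed interval [[0, T]]. A single integral over a domain
independent of [t] suits dominated convergence and Lipschitz estimates, and the
formula makes sense for every real [t]. *)
Definition double_prim (u : R -> R) (t : R) : R :=
  \int[mu]_(s in `[0, T]) (ramp t s * u s).

Definition prim (u : R -> R) (t : R) : R := \int[mu]_(s in `[0, t]) u s.

Let mI : measurable (`[0, T]%classic : set Rm).
Proof. exact: measurable_itv. Qed.

Lemma measurable_patch (A : set Rm) (v : R -> R) : measurable A ->
  measurable_fun (setT : set Rm) v ->
  measurable_fun (setT : set Rm) (v \_ A : R -> R).
Proof.
move=> mA mv; apply: (@measurable_restrictT _ _ Rm Rm A v mA).1.
exact: measurable_funTS.
Qed.

Lemma integrable_dominator (A : set Rm) :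
  measurable A -> mu.-integrable A (EFin \o m).
Proof. by move=> mA; apply: integrableS m_int. Qed.

Lemma integrable_le (A : set Rm) (c : R) (v : R -> R) : measurable A ->
  measurable_fun A v -> (forall s, A s -> `|v s| <= c * m s) ->
  mu.-integrable A (EFin \o v).
Proof.
move=> mA mv vm; have im := integrableZl mA c (integrable_dominator mA).
apply: (le_integrable mA _ _ im); first exact/measurable_EFinP.
move=> s As /=; rewrite lee_fin (le_trans (vm s As)) //.
exact: ler_norm.
Qed.

Lemma dominated_integrable u (A : set Rm) : dominated u -> measurable A ->
  mu.-integrable A (EFin \o u).
Proof.
move=> [mfu um] mA; apply: (@integrable_le _ 1) => //.
  exact: measurable_funTS.
by move=> s _; rewrite mul1r.
Qed.

Lemma norm_Rintegral_le (A : set Rm) (c : R) (v : R -> R) : measurable A ->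
  measurable_fun A v -> (forall s, A s -> `|v s| <= c * m s) ->
  `|\int[mu]_(s in A) v s| <= c * \int[mu]_(s in A) m s.
Proof.
move=> mA mv vm; have iv := integrable_le mA mv vm.
apply: (le_trans (le_normr_Rintegral mA iv)).
rewrite -RintegralZl //; last exact: integrable_dominator.
apply: le_Rintegral => //; first exact: integrable_norm.
exact: integrableZl (integrable_dominator mA).
Qed.

Lemma ramp_lipschitz t t' s : `|ramp t s - ramp t' s| <= `|t - t'|.
Proof.
rewrite /ramp; case: (leP 0 (t - s)); case: (leP 0 (t' - s)) => h1 h2;
  case: (ger0P (t - t')) => h3; rewrite ler_norml; lra.
Qed.

Lemma ramp0 t s : t <= s -> ramp t s = 0.
Proof. by move=> ts; rewrite /ramp max_l // subr_le0. Qed.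

Lemma measurable_ramp t : measurable_fun (setT : set Rm) (ramp t).
Proof.
apply: measurable_maxr; first exact: measurable_cst.
by apply: measurable_funB; [exact: measurable_cst|exact: measurable_id].
Qed.

Lemma norm_ramp_le t s : 0 <= s -> `|ramp t s| <= `|t|.
Proof.
move=> s0; rewrite /ramp ger0_norm ?le_max ?lexx // ge_max normr_ge0 /=.
by have := ler_norm t; lra.
Qed.

Lemma double_prim_integrable u t : dominated u ->
  mu.-integrable `[0, T] (EFin \o (fun s => ramp t s * u s)).
Proof.
move=> [mfu um]; apply: (@integrable_le _ `|t|) => //.
  by apply: measurable_funTS; apply: measurable_funM => //; exact: measurable_ramp.
move=> s; rewrite /= in_itv /= => /andP[s0 _]; rewrite normrM.
by apply: ler_pM => //; exact: norm_ramp_le.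
Qed.

Lemma double_prim0 u t : t <= 0 -> double_prim u t = 0.
Proof.
move=> t0; rewrite /double_prim (@eq_Rintegral _ _ _ mu _ (fun=> 0)); first by
  rewrite Rintegral_cst // mul0r.
move=> s; rewrite inE /= in_itv /= => /andP[s0 _].
by rewrite ramp0 ?mul0r // (le_trans t0).
Qed.

Lemma double_prim_lipschitz u t t' : dominated u ->
  `|double_prim u t - double_prim u t'| <= mass * `|t - t'|.
Proof.
move=> du; rewrite /double_prim -RintegralB //; [|exact: double_prim_integrable..].
rewrite mulrC; apply: norm_Rintegral_le => //.
  apply: measurable_funTS; case: du => mfu _.
  by apply: measurable_funB; apply: measurable_funM => //; exact: measurable_ramp.
move=> s _; rewrite -mulrBl normrM; case: du => _ um.
by apply: ler_pM => //; exact: ramp_lipschitz.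
Qed.

Lemma norm_double_prim_le u t : dominated u -> `|double_prim u t| <= mass * `|t|.
Proof.
move=> du; have := double_prim_lipschitz t 0 du.
by rewrite (double_prim0 _ (lexx 0)) !subr0.
Qed.

Lemma norm_prim_le u t : dominated u -> 0 <= t <= T -> `|prim u t| <= mass.
Proof.
move=> du /andP[t0 tT].
have -> : prim u t = \int[mu]_(s in `[0, T]) (u \_ `[0, t]) s.
  rewrite -Rintegral_mkcondr; congr (Rintegral _ _ _).
  apply/seteqP; split => s /=; rewrite !in_itv /=; lra.
rewrite -[leRHS]mul1r; case: du => mfu um; apply: norm_Rintegral_le => //.
  by apply/measurable_restrict => //; exact: measurable_funTS.
move=> s _; rewrite mul1r patchE; case: ifP => // _.
by rewrite normr0 (le_trans _ (um s)).
Qed.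

(** The remainder is the integral of [u] against a kernel that is bounded by
[|t' - t|] and vanishes outside the interval between [t] and [t'], whose integral
of [|u|] is small by absolute continuity. The modulus [d] does not depend on [t];
one-sided derivatives at the end points are included. *)
Lemma double_prim_derivative u (e : R) : dominated u -> 0 < e -> exists2 d, 0 < d &
  forall t t', 0 <= t <= T -> 0 <= t' <= T -> `|t' - t| < d ->
  `|double_prim u t' - double_prim u t - (t' - t) * prim u t| <= e * `|t' - t|.
Proof.
move=> du e0; have iu := dominated_integrable du measurableT.
have [d [d0 Hd]] := integral_normr_continuous iu e0.
exists d => // t t' t0T t'0T tt'.
pose A : set R := `[Num.min t t', Num.max t t']%classic.
have mA : measurable (A : set Rm) by exact: measurable_itv.
have muA : (mu A < d%:E)%E.
  rewrite lebesgue_measure_itv /=; case: ifPn => // _.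
  rewrite -EFinB lte_fin; apply: le_lt_trans tt'.
  by case: (leP t t') => h; case: (ger0P (t' - t)); lra.
have := ltW (Hd A mA muA).
set J := Rintegral _ _ _ => JE.
have [mfu um] := du.
have mprim : measurable_fun (setT : set Rm) (u \_ `[0, t]).
  exact: measurable_patch.
have iprim : mu.-integrable `[0, T] (EFin \o (fun s => (t' - t) * (u \_ `[0, t]) s)).
  apply: (@integrable_le _ `|t' - t|) => //.
    apply: measurable_funTS; apply: measurable_funM; last exact: mprim.
    exact: measurable_cst.
  move=> s _; rewrite normrM; apply: ler_wpM2l => //.
  by rewrite patchE; case: ifP => // _; rewrite normr0 (le_trans _ (um s)).
have -> : double_prim u t' - double_prim u t - (t' - t) * prim u t =
    \int[mu]_(s in `[0, T]) (ramp t' s * u s - ramp t s * u s -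
      (t' - t) * (u \_ `[0, t]) s).
  rewrite RintegralB //; last first.
    have := integrableB mI (double_prim_integrable t' du) (double_prim_integrable t du).
    exact.
  rewrite RintegralB //; [|exact: double_prim_integrable..].
  congr (_ - _); rewrite RintegralZl //; last first.
    apply: (@integrable_le _ 1) => //; first exact: measurable_funTS.
    move=> s _; rewrite mul1r.
    by rewrite patchE; case: ifP => // _; rewrite normr0 (le_trans _ (um s)).
  congr (_ * _); rewrite -Rintegral_mkcondr; congr (Rintegral _ _ _).
  by apply/seteqP; split => s /=; rewrite !in_itv /=; lra.
have inormA : mu.-integrable `[0, T]
    (EFin \o (fun s => `|t' - t| * ((fun s : R => `|u s|) \_ (A : set R)) s)).
  apply: (@integrable_le _ `|t' - t|) => //.
    apply: measurable_funTS; apply: measurable_funM; first exact: measurable_cst.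
    by apply: measurable_patch => //; exact: measurableT_comp.
  move=> s _; rewrite normrM normr_id; apply: ler_wpM2l => //.
  rewrite patchE; case: ifP => // _; first by rewrite normr_id.
  by rewrite normr0 (le_trans _ (um s)).
have iK : mu.-integrable `[0, T] (EFin \o (fun s => ramp t' s * u s -
    ramp t s * u s - (t' - t) * (u \_ `[0, t]) s)).
  have := integrableB mI (integrableB mI (double_prim_integrable t' du)
    (double_prim_integrable t du)) iprim.
  exact.
have key (s : R) : 0 <= s -> s <= T ->
    `|ramp t' s * u s - ramp t s * u s - (t' - t) * (u \_ `[0, t]) s| <=
    `|t' - t| * ((fun s : R => `|u s|) \_ (A : set R)) s.
  move=> s0 sT.
  have -> : (u \_ `[0, t]) s = (s <= t)%R%:R * u s.
    rewrite patchE; case: ifPn => [/set_mem|/negP sI].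
      by rewrite /= in_itv /= => /andP[_ ->]; rewrite mul1r.
    case: (leP s t) => st; last by rewrite mul0r.
    by exfalso; apply: sI; apply/mem_set; rewrite /= in_itv /= s0.
  have -> : ((fun s : R => `|u s|) \_ (A : set R)) s = (s \in A)%:R * `|u s|.
    by rewrite patchE; case: ifP => _; rewrite ?mul1r ?mul0r.
  rewrite (_ : _ - _ = (ramp t' s - ramp t s - (t' - t) * (s <= t)%R%:R) * u s);
    last by ring.
  rewrite [leRHS]mulrA normrM; apply: ler_wpM2r => //.
  case: (boolP (s \in A)) => [_|/negP sA].
    rewrite mulr1; case: (leP s t) => st; last by rewrite mulr0 subr0 ramp_lipschitz.
    have -> : ramp t s = t - s by rewrite /ramp max_r // subr_ge0.
    by rewrite /ramp ler_norml mulr1; case: (leP 0 (t' - s));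
      case: (ger0P (t' - t)); lra.
  have : ~~ (Num.min t t' <= s <= Num.max t t').
    by apply/negP => h; apply: sA; apply/mem_set; rewrite /A /= in_itv.
  rewrite negb_and -!ltNge mulr0 => /orP[|].
    rewrite lt_min => /andP[st st'].
    by rewrite /ramp (ltW st) !max_r ?subr_ge0 ?(ltW st) ?(ltW st') // mulr1
      (_ : _ - _ = 0) ?normr0 //; ring.
  rewrite gt_max => /andP[ts t's].
  by rewrite !ramp0 ?(ltW ts) ?(ltW t's) // (leNgt s t) ts mulr0 !subr0 normr0.
apply: (@le_trans _ _ (\int[mu]_(s in `[0, T])
    (`|t' - t| * ((fun s : R => `|u s|) \_ (A : set R)) s))).
  apply: (le_trans (le_normr_Rintegral mI iK)).
  apply: le_Rintegral => //; first exact: integrable_norm.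
  by move=> s /=; rewrite in_itv /= => /andP[s0 sT]; exact: key.
rewrite RintegralZl // -?Rintegral_mkcondr.
  rewrite mulrC; apply: ler_wpM2r => //.
  apply: le_trans JE; rewrite le_eqVlt; apply/orP; left; apply/eqP.
  rewrite /J; congr (Rintegral _ _ _); apply/setIidr => s.
  by rewrite /A /= !in_itv /= minElt maxElt; case: ifP => _; lra.
apply: (@integrable_le _ 1) => //.
  apply: measurable_funTS; apply: measurable_patch => //.
  exact: measurableT_comp.
move=> s _; rewrite mul1r patchE; case: ifP => // _; first by rewrite normr_id.
by rewrite normr0 (le_trans _ (um s)).
Qed.

Lemma prim_increment u p q : dominated u -> 0 <= p -> p <= q ->
  `|prim u q - prim u p| <= \int[mu]_(s in `]p, q[) `|u s|.
Proof.
move=> du p0 pq.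
have iu (A : set Rm) : measurable A -> mu.-integrable A (EFin \o u).
  exact: dominated_integrable.
rewrite /prim Rintegral_itvB ?bnd_simp //; last exact: iu.
rewrite -Rintegral_itv_bndo_bndc; last exact: iu.
by apply: le_normr_Rintegral => //; exact: iu.
Qed.

(** The sum of the increments is at most the integral of [|u|] over the union of
the intervals, a set of small measure. *)
Lemma prim_absolutely_continuous u : dominated u ->
  absolutely_continuous_on `[0, T] (prim u).
Proof.
move=> du e e0; have iu := dominated_integrable du measurableT.
have [d [d0 Hd]] := integral_normr_continuous iu e0.
exists d => // n p q pq tpq sd.
have mJ (i : 'I_n) : measurable (`]p i, q i[%classic : set Rm).
  exact: measurable_itv.
pose U : set Rm := \big[setU/set0]_(i < n) `]p i, q i[%classic.
have mU : measurable U by exact: bigsetU_measurable.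
have muU : (mu U < d%:E)%E.
  rewrite /U measure_bigsetU_ord //.
  rewrite (eq_bigr (fun i => (q i - p i)%:E)); first by rewrite sumEFin lte_fin.
  move=> i _; have [_ _ piqi] := pq i.
  rewrite [LHS](lebesgue_measure_itv `]p i, q i[) /= lte_fin.
  case: ifPn => [_|]; first by rewrite -EFinB.
  rewrite -leNgt => qipi.
  by rewrite (_ : p i = q i) ?subrr //; apply/le_anti; rewrite piqi.
apply: le_lt_trans (Hd U mU muU).
have -> : \int[mu]_(s in U) `|u s| = \sum_(i < n) \int[mu]_(s in `]p i, q i[) `|u s|.
  rewrite /Rintegral /U integral_bigsetU_EFin //.
  - rewrite sum_fine // => i _; apply: integrable_fin_num => //.
    by apply: integrable_norm; exact: dominated_integrable.
  - exact: index_enum_uniq.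
  - by apply: sub_trivIset tpq.
  - apply: measurable_funTS; apply/measurable_EFinP.
    by apply: measurableT_comp => //; case: du.
apply: ler_sum => i _; apply: prim_increment => //; last by case: (pq i).
by case: (pq i) => /=; rewrite in_itv /= => /andP[].
Qed.

Lemma prim_ae_derivative u : dominated u ->
  {ae mu, forall t : R, 0 < t -> is_derive t 1 (prim u) (u t)}.
Proof.
move=> du.
have iu (A : set Rm) : measurable A -> mu.-integrable A (EFin \o u).
  exact: dominated_integrable.
have := @FTC1 R u (BLeft 0) (fun y => iu _ (measurable_itv _)).
have lu : locally_integrable setT u.
  by apply: open_integrable_locally; [exact: openT|exact: iu].
move=> /(_ lu); apply: filterS; first exact: (ae_filter_ringOfSetsType mu).
move=> t /= H t0.
have [|dv vE] := H; first by rewrite lte_fin.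
apply: DeriveDef; first exact: dv.
by rewrite -derive1E; exact: vE.
Qed.

Lemma double_prim_cvg (v : nat -> R -> R) u t : (forall n, dominated (v n)) ->
  dominated u -> {ae mu, forall s : R, 0 <= s <= T -> v ^~ s @ \oo --> u s} ->
  double_prim (v n) t @[n --> \oo] --> double_prim u t.
Proof.
move=> dv du vu.
have md (w : R -> R) : dominated w ->
    measurable_fun (`[0, T]%classic : set Rm) (fun s => (ramp t s * w s)%:E).
  move=> [mw _]; apply/measurable_EFinP; apply: measurable_funTS.
  by apply: measurable_funM => //; exact: measurable_ramp.
have := @dominated_convergence _ Rm R mu `[0, T]%classic mI
  (fun n s => (ramp t s * v n s)%:E) (fun s => (ramp t s * u s)%:E)
  (fun s => `|t|%:E * (m s)%:E)%E.
case.
- by move=> n; exact: md.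
- exact: md.
- move: vu; apply: filterS; first exact: (ae_filter_ringOfSetsType mu).
  move=> s + sT; rewrite /= in_itv /= in sT => /(_ sT) vu.
  apply: cvg_EFin; first by near=> n.
  by apply: cvgM => //; exact: cvg_cst.
- exact: integrableZl (integrable_dominator mI).
- apply: aeW => s n; rewrite /= in_itv /= => /andP[s0 _].
  rewrite lee_fin normrM; apply: ler_pM => //; first exact: norm_ramp_le.
  by case: (dv n).
move=> _ _ c; rewrite /double_prim /Rintegral; apply: fine_cvg.
by rewrite fineK //; apply: integrable_fin_num => //; exact: double_prim_integrable.
Unshelve. all: by end_near. Qed.

End DoublePrimitive.

(** * A two-point problem with delay *)

Section Tonelli.
Context {R : realType} (T : R) (m : R -> R).
Local Notation Rm := (measurableTypeR R).
Local Notation mu := (@lebesgue_measure R).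
Hypothesis T_gt0 : 0 < T.
Hypothesis m_int : mu.-integrable (setT : set Rm) (EFin \o m).
Variable F : R -> R -> R.
Hypothesis F_measurable : forall z, measurable_fun (setT : set Rm) (F ^~ z).
Hypothesis F_continuous : forall t, continuous (F t).
Hypothesis F_bound : forall t z, `|F t z| <= m t.

(** [w] is the limit of its roundings to multiples of [1 / (n + 1)], and for a
function with countably many values the composite is measurable piece by
piece. *)
Lemma measurable_superposition (w : R -> R) :
  measurable_fun (setT : set Rm) w ->
  measurable_fun (setT : set Rm) (fun s => F s (w s)).
Proof.
move=> mw.
pose b (n : nat) (j : int) : R := j%:~R / n.+1%:R.
pose J (n : nat) (s : R) : int := Num.floor (w s * n.+1%:R).
have Jb n s : b n (J n s) <= w s < b n (J n s + 1).
  by rewrite /b /J ler_pdivrMr // ltr_pdivlMr // floor_itv.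
apply: (@measurable_fun_cvg _ Rm R setT (fun n s => F s (b n (J n s)))).
  move=> n _ Y mY; rewrite setTI.
  rewrite [X in measurable X](_ : _ = \bigcup_k
      (if unpickle k is Some j then w @^-1` `[b n j, b n (j + 1)[ `&`
         (F ^~ (b n j)) @^-1` Y else set0)).
    apply: bigcupT_measurable => k; case: unpickle => [j|]; last exact: measurable0.
    apply: measurableI; rewrite -[X in measurable X]setTI.
      by apply: mw => //; exact: measurable_itv.
    exact: F_measurable.
  apply/seteqP; split => s /=.
    move=> Ys; exists (pickle (J n s)); first exact: I.
    by rewrite pickleK; split => //=; rewrite in_itv; exact: Jb.
  move=> [k _]; case: unpickle => // j [] /=; rewrite in_itv /= => wj.
  suff -> : J n s = j by [].
  by apply: floor_def; move: wj; rewrite /b ler_pdivrMr // ltr_pdivlMr.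
move=> s _; apply: (@cvg_comp _ _ _ (fun n => b n (J n s)) (F s));
  last exact: F_continuous.
apply: (@squeeze_cvgr _ _ _ _ (fun n => w s - n.+1%:R^-1) (fun=> w s)).
- near=> n; have := Jb n s.
  rewrite (_ : b n (J n s + 1) = b n (J n s) + n.+1%:R^-1).
    by move: (b n _) (_^-1) => x y; lra.
  by rewrite /b intrD mulrDl mul1r.
- rewrite -[X in _ --> X]subr0; apply: cvgB; first exact: cvg_cst.
  exact: cvg_harmonic.
- exact: cvg_cst.
Unshelve. all: by end_near. Qed.

Variable N : nat.

Let h : R := T / N.+1%:R.

Definition delay (s : R) : R := Num.max 0 (s - h).

(** Picard iterates of the equation [y'' = F(t, y(t - h))], [y(0) = 0],
[y'(0) = c]. The delay makes them stationary: the iterate [i] is already a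
solution on [[0, i h]] ([tonelli_stable]). *)
Fixpoint tonelli (i : nat) (c t : R) : R :=
  if i is j.+1 then c * t + double_prim T (fun s => F s (tonelli j c (delay s))) t
  else 0.

Let h_gt0 : 0 < h. Proof. by rewrite divr_gt0. Qed.

Lemma delay_ge0 s : 0 <= delay s. Proof. by rewrite /delay le_max lexx. Qed.

Lemma delay_continuous : continuous delay.
Proof.
move=> s; apply: (@continuous_max _ _ (fun=> 0) (fun s => s - h)).
  exact: cvg_cst.
by apply: cvgB; [exact: cvg_id|exact: cvg_cst].
Qed.

Lemma double_prim_continuous u : dominated m u -> continuous (double_prim T u).
Proof.
move=> du t; apply/cvgrPdist_le => e e0.
have M1 : 0 < `|mass T m| + 1 by apply: ltr_wpDl.
near=> t'.
have tt' : `|t - t'| <= e / (`|mass T m| + 1).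
  by near: t'; apply: cvgr_dist_le => //; exact: divr_gt0.
apply: (le_trans (double_prim_lipschitz T m_int t t' du)).
apply: (@le_trans _ _ ((`|mass T m| + 1) * `|t - t'|)).
  by apply: ler_wpM2r => //; have := ler_norm (mass T m); lra.
by rewrite mulrC -ler_pdivlMr.
Unshelve. all: by end_near. Qed.

Lemma affine_double_prim_continuous u (c : R) : dominated m u ->
  continuous (fun t : R => c * t + double_prim T u t).
Proof.
move=> du t; apply: (@cvgD _ _ _ _ _ (fun t => c * t) (double_prim T u)).
  by apply: cvgM; [exact: cvg_cst|exact: cvg_id].
exact: double_prim_continuous.
Qed.

Lemma delayed_dominated (y : R -> R) : continuous y ->
  dominated m (fun s => F s (y (delay s))).
Proof.
move=> cy; split; last by move=> s; exact: F_bound.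
apply: measurable_superposition; apply: continuous_measurable_fun => s.
by apply: (@continuous_comp _ _ _ delay y); [exact: delay_continuous|exact: cy].
Qed.

Lemma tonelli_continuous i c : continuous (tonelli i c).
Proof.
elim: i => [|i IH] /=; first by move=> t; exact: cvg_cst.
by apply: affine_double_prim_continuous; exact: delayed_dominated.
Qed.

Lemma tonelli_dominated i c :
  dominated m (fun s => F s (tonelli i c (delay s))).
Proof. exact: delayed_dominated (@tonelli_continuous i c). Qed.

Lemma eq_double_prim u v t : (forall s, 0 <= s <= T -> s < t -> u s = v s) ->
  double_prim T u t = double_prim T v t.
Proof.
move=> uv; apply: eq_Rintegral => s /set_mem; rewrite /= in_itv /= => sT.
by have [ts|st] := leP t s; [rewrite !ramp0 ?mul0r|rewrite uv].
Qed.

Lemma tonelli_stable i c t : 0 <= t -> t <= i%:R * h ->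
  tonelli i.+1 c t = tonelli i c t.
Proof.
elim: i t => [|i IH] t t0.
  by rewrite mul0r => t0'; rewrite /= double_prim0 // (_ : t = 0) ?mulr0 ?addr0 //; lra.
rewrite -natr1 mulrDl mul1r => ti.
rewrite [LHS]/= [RHS]/=; congr (_ + _); apply: eq_double_prim => s /andP[s0 _] st.
congr (F s _); apply: IH; first exact: delay_ge0.
by rewrite /delay ge_max mulr_ge0 ?(ltW h_gt0) //=; lra.
Qed.

Lemma tonelli_param_continuous i t : continuous (fun c : R => tonelli i c t).
Proof.
elim: i t => [|i IH] t c /=; first exact: cvg_cst.
apply: cvgD; first by apply: cvgM; [exact: cvg_id|exact: cvg_cst].
have mI : measurable (`[0, T]%classic : set Rm) by exact: measurable_itv.
have := @continuity_under_integral R _ Rm mu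
  (fun c s => ramp t s * F s (tonelli i c (delay s))) `[0, T]%classic mI
  (c - 1) (c + 1) _ _ (fun s => `|t| * m s) _ _ c.
apply.
- by move=> x _; apply: (double_prim_integrable T m_int); exact: tonelli_dominated.
- apply: aeW => s _ x _; apply: cvgM; first exact: cvg_cst.
  apply: (@cvg_comp _ _ _ (fun c => tonelli i c (delay s)) (F s)); first exact: IH.
  exact: F_continuous.
- exact: integrableZl (integrable_dominator m_int mI).
- move=> x _; apply: aeW => s; rewrite /= in_itv /= => /andP[s0 _].
  by rewrite normrM; apply: ler_pM => //; exact: norm_ramp_le.
- by apply/mem_set; rewrite /= in_itv /= ltrDl gtrDl oppr_lt0 ltr01.
Qed.

(** Intermediate value theorem: [S] is below [b] at the left end of the interval
and above [b] at the right end. *)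
Lemma near_linear_surjective (S : R -> R) (M b : R) : continuous S ->
  (forall c, `|S c - c * T| <= M * T) ->
  exists2 c, b / T - M <= c <= b / T + M & S c = b.
Proof.
move=> cS Sb.
have M0 : 0 <= M by have := le_trans (normr_ge0 _) (Sb 0); rewrite pmulr_lge0.
have [|||c] := @IVT R S (b / T - M) (b / T + M) b.
- lra.
- exact: continuous_subspaceT.
- have := Sb (b / T - M); have := Sb (b / T + M).
  rewrite mulrDl mulrBl divfK ?gt_eqF // !ler_norml => S1 S2.
  have h1 : S (b / T - M) <= b by lra.
  have h2 : b <= S (b / T + M) by lra.
  by rewrite ge_min h1 le_max h2 orbT.
by rewrite in_itv; exists c.
Qed.

Lemma tonelli_bvp (b : R) : exists c : R, exists y : R -> R,
  [/\ b / T - mass T m <= c <= b / T + mass T m,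
      continuous y,
      forall t, y t = c * t + double_prim T (fun s => F s (y (delay s))) t &
      y T = b].
Proof.
have [||c cI Sc] := @near_linear_surjective (fun c => tonelli N.+2 c T) (mass T m) b.
- exact: tonelli_param_continuous.
- move=> c; rewrite /= addrAC subrr add0r -[X in _ * X](gtr0_norm T_gt0).
  exact: (norm_double_prim_le T m_int _ (tonelli_dominated N.+1 c)).
exists c, (tonelli N.+2 c); split; [exact: cI|exact: tonelli_continuous| |exact: Sc].
move=> t; rewrite [LHS]/=; congr (_ + _); apply: eq_double_prim => s /andP[s0 sT] st.
congr (F s _); symmetry; apply: tonelli_stable; first exact: delay_ge0.
rewrite mulrC divfK ?pnatr_eq0 // /delay ge_max (ltW T_gt0) /=.
have := h_gt0; move: h sT => x sT; lra.
Qed.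

End Tonelli.

(** * Compactness of equi-Lipschitz sequences *)

Section LipschitzCompactness.
Context {R : realType} (T L : R) (y : nat -> R -> R).
Hypothesis T_gt0 : 0 < T.
Hypothesis y_lipschitz : forall n s t, `|y n s - y n t| <= L * `|s - t|.
Hypothesis y0 : forall n, y n 0 = 0.

(** The values at [t] stay in a segment, so by the Tychonoff theorem the sequence
has a cluster point for pointwise convergence; its basic neighbourhoods only see
finitely many points. *)
Lemma pointwise_cluster : exists z : R -> R,
  forall (k n : nat) (p : 'I_k -> R) (e : R), 0 < e ->
  exists2 N, (n <= N)%N & forall i, `|z (p i) - y N (p i)| < e.
Proof.
pose K (_ : R) : topologicalType := R.
pose A (t : R) : set (K t) := `[- (L * `|t|), L * `|t|]%classic.
have cA t : compact (A t) by exact: segment_compact.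
have := tychonoff cA.
move=> /(_ ((y : nat -> prod_topology K) @ \oo)).
case.
  exists 0%N => // n _ t; rewrite /A /= in_itv /= -ler_norml.
  by have := y_lipschitz n t 0; rewrite y0 !subr0.
move=> z [_ zc]; exists z => k n p e e0.
have [] := zc [set w : prod_topology K | exists2 N, (n <= N)%N & w = y N]
  [set w : prod_topology K | forall i, `|z (p i) - w (p i)| < e].
- by exists n => // N nN; exists N.
- apply: (@filter_forall (prod_topology K) 'I_k
    (fun i w => `|z (p i) - w (p i)| < e) (nbhs (z : prod_topology K))
    (nbhs_filter _)) => i.
  have H : (fun w : prod_topology K => w (p i) : R) @ (z : prod_topology K)
      --> (z (p i) : R) by exact: (@proj_continuous R K (p i) z).
  by apply: (@cvgr_dist_lt R R _ _ _ _ _ H e e0); exact: (nbhs_filter _).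
by move=> _ [[N nN ->] /= zN]; exists N.
Qed.

(** The index [e n] is chosen so that [y (e n)] is within [1 / (n + 1)] of the
cluster point on a grid of step [T / (n + 1)]; the common Lipschitz constant takes
care of the points between the nodes. *)
Lemma lipschitz_subsequence : exists (e : nat -> nat) (z : R -> R),
  (forall n, (n <= e n)%N) /\
  forall t, 0 <= t <= T -> y (e n) t @[n --> \oo] --> z t.
Proof.
have [z zP] := pointwise_cluster.
have L0 : 0 <= L.
  by have := le_trans (normr_ge0 _) (y_lipschitz 0 1 0); rewrite subr0 normr1 mulr1.
have z_lipschitz s t : `|z s - z t| <= L * `|s - t|.
  apply/ler_addgt0Pr => e e0.
  have e2 : 0 < e / 2 by rewrite divr_gt0.
  have [N _ zN] := zP 2%N 0%N (fun i => if i == ord0 then s else t) _ e2.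
  have := zN ord0; have := zN ord_max; rewrite /= !ltr_norml => zt zs.
  have := y_lipschitz N s t; rewrite !ler_norml => ys; lra.
have /choice[e eP] : forall n : nat, exists N, (n <= N)%N /\
    forall i : 'I_n.+2, `|z (i%:R * (T / n.+1%:R)) - y N (i%:R * (T / n.+1%:R))|
      < n.+1%:R^-1.
  move=> n; have n0 : 0 < n.+1%:R^-1 :> R by rewrite invr_gt0.
  have [N nN zN] := zP n.+2 n (fun i => i%:R * (T / n.+1%:R)) _ n0.
  by exists N.
exists e, z; split => [n|t /andP[t0 tT]]; first by case: (eP n).
have bnd n : `|z t - y (e n) t| <= (2 * (L * T) + 1) * n.+1%:R^-1.
  have [_ zn] := eP n.
  (* the node just below t; t = T may give i = n + 1, hence n + 2 nodes *)
  pose i := Num.truncn (t / (T / n.+1%:R)).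
  have h0 : 0 < T / n.+1%:R by rewrite divr_gt0.
  have /andP[it ti] := truncn_itv (divr_ge0 t0 (ltW h0)).
  have iN : (i < n.+2)%N.
    rewrite ltnS -(@ler_nat R) (le_trans it) // ler_pdivrMr //.
    by rewrite mulrC divfK // pnatr_eq0.
  have := zn (Ordinal iN); rewrite /= => {}zn.
  move: it ti; rewrite ler_pdivlMr // ltr_pdivrMr // -/i -[i.+1%:R]natr1 mulrDl mul1r => it ti.
  pose p : R := i%:R * (T / n.+1%:R).
  have tp : `|t - p| <= T / n.+1%:R.
    move: it ti; rewrite -/p; move: (T / _) p => x p it ti.
    by rewrite ger0_norm; lra.
  have l1 := z_lipschitz t p.
  have l2 := y_lipschitz (e n) t p.
  have l3 : L * `|t - p| <= L * (T / n.+1%:R) by exact: ler_wpM2l.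
  move: zn l1 l2 l3; rewrite -/p mulrDl -!mulrA mul1r.
  set a := L * `|t - p|; set b := L * (T / _); set c := n.+1%:R^-1.
  clearbody a b c; rewrite !ler_norml !ltr_norml => /andP[? ?] /andP[? ?] /andP[? ?] ?.
  by apply/andP; split; lra.
have C0 : 0 < 2 * (L * T) + 1 by rewrite ltr_wpDl // !mulr_ge0 // ltW.
apply/cvgrPdist_le => d d0.
have dC : 0 < d / (2 * (L * T) + 1) by rewrite divr_gt0.
near=> n; apply: (le_trans (bnd n)).
rewrite mulrC -ler_pdivlMr //; apply: ltW.
by near: n; exact: near_infty_natSinv_lt (PosNum dC).
Unshelve. all: by end_near. Qed.

End LipschitzCompactness.

(** * The unfolded two-point problem *)

Section FoldedProblem.
Context {R : realType} (a T : R) (m : R -> R) (g : R -> R -> R) (k : nat).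
Local Notation Rm := (measurableTypeR R).
Local Notation mu := (@lebesgue_measure R).
Hypothesis a_gt0 : 0 < a.
Hypothesis T_gt0 : 0 < T.
Hypothesis m_int : mu.-integrable (setT : set Rm) (EFin \o m).
Hypothesis g_measurable : forall x, measurable_fun (setT : set Rm) (g ^~ x).
Hypothesis g_continuous : forall t, continuous (g t).
Hypothesis g_bound : forall t x, `|g t x| <= m t.

Let b : R := 2 * k%:R * a.

Hypothesis fast : 2 * mass T m < b / T.

Definition smoothed (n : nat) (t z : R) : R :=
  fold_slope a k n z * g t (fold a k z).

Lemma smoothed_measurable n z : measurable_fun (setT : set Rm) (smoothed n ^~ z).
Proof. by apply: measurable_funM; [exact: measurable_cst|exact: g_measurable]. Qed.

Lemma smoothed_continuous n t : continuous (smoothed n t).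
Proof.
move=> z; apply: cvgM; first exact: fold_slope_continuous.
apply: (@cvg_comp _ _ _ (fold a k) (g t)); first exact: fold_continuous.
exact: g_continuous.
Qed.

Lemma smoothed_bound n t z : `|smoothed n t z| <= m t.
Proof.
rewrite /smoothed normrM -[leRHS]mul1r.
by apply: ler_pM => //; exact: norm_fold_slope_le.
Qed.

Lemma smoothed_cvg j (e : nat -> nat) (w : nat -> R) t (z : R) :
  (j <= k)%N -> wall a j - 2 * a < z < wall a j ->
  (forall n, (n <= e n)%N) -> w @ \oo --> z ->
  smoothed (e n) t (w n) @[n --> \oo] --> (-1) ^+ j * g t (fold a k z).
Proof.
move=> jk zj he wz; apply: cvgM; first exact: (fold_slope_cvg a_gt0 jk zj he wz).
apply: (@cvg_comp _ _ _ w (fun z => g t (fold a k z))); first exact: wz.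
apply: (@cvg_comp _ _ _ (fold a k) (g t)); first exact: fold_continuous.
exact: g_continuous.
Qed.

(** Each level set of an injective function has at most one point. *)
Lemma negligible_level_sets (z : R -> R) (K : set R) :
  (forall s t, K s -> K t -> z s = z t -> s = t) ->
  mu.-negligible [set s | K s /\ exists j, z s = wall a j].
Proof.
move=> zinj; rewrite (_ : [set s | _] = \bigcup_j [set s | K s /\ z s = wall a j]).
  apply: negligible_bigcup => j.
  have [[s [Ks zs]]|nos] := pselect (exists s, K s /\ z s = wall a j).
    exists [set s]; split; [exact: measurable_set1|exact: lebesgue_measure_set1|].
    by move=> t [Kt zt]; apply: zinj => //; rewrite zt.
  apply: negligibleS (@negligible_set0 _ _ _ mu) => t Kt.
  by apply: nos; exists t.
by apply/seteqP; split => s [] => [Ks [j zj]|j _ [Ks zj]]; [exists j|split => //; exists j].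
Qed.

(** Limit of the solutions of the smoothed and delayed problems. Their velocities
are at least [d = b / T - 2 mass > 0], and so the limit [z] grows at least at this
rate: it is injective, hence off the walls at almost every time. At such a time
the smoothed forces converge, which gives [u] and, by dominated convergence, the
integral equation of [z]. *)
Lemma folded_bvp : exists (u : R -> R) (c : R),
  [/\ dominated m u,
      b / T - mass T m <= c,
      c * T + double_prim T u T = b &
      {ae mu, forall s : R, 0 <= s <= T -> forall j, (j <= k)%N ->
        wall a j - 2 * a < c * s + double_prim T u s < wall a j ->
        u s = (-1) ^+ j * g s (fold a k (c * s + double_prim T u s))}].
Proof.
pose M := mass T m.
have /choice[c_ /choice[y_ H]] : forall n, exists c : R, exists y : R -> R,
  [/\ b / T - M <= c <= b / T + M, continuous y,
      forall t, y t = c * t + double_prim T (fun s => smoothed n s (y (delay T n s))) t &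
      y T = b].
  move=> n; exact: (tonelli_bvp T_gt0 m_int (@smoothed_measurable n)
    (@smoothed_continuous n) (@smoothed_bound n) n b).
pose u_ n s := smoothed n s (y_ n (delay T n s)).
have du n : dominated m (u_ n).
  have [_ cy _ _] := H n.
  exact: (delayed_dominated T (@smoothed_measurable n) (@smoothed_continuous n)
    (@smoothed_bound n) n cy).
have yE n t : y_ n t = c_ n * t + double_prim T (u_ n) t by have [] := H n.
have yT n : y_ n T = b by have [] := H n.
have cb n : b / T - M <= c_ n <= b / T + M by have [] := H n.
have b0 : 0 <= b by rewrite !mulr_ge0 // ltW.
have bT0 : 0 <= b / T by rewrite divr_ge0 // ltW.
have dl n s t := double_prim_lipschitz T m_int s t (du n).
have M0 : 0 <= M.
  have := le_trans (normr_ge0 _) (dl 0%N 1 0).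
  by rewrite subr0 normr1 mulr1.
have y_lip n s t : `|y_ n s - y_ n t| <= (b / T + 2 * M) * `|s - t|.
  rewrite !yE (_ : _ - _ =
    c_ n * (s - t) + (double_prim T (u_ n) s - double_prim T (u_ n) t)); last by ring.
  apply: (le_trans (ler_normD _ _)); rewrite normrM.
  apply: (@le_trans _ _ ((b / T + M) * `|s - t| + M * `|s - t|)).
    apply: lerD; last exact: dl.
    apply: ler_wpM2r => //; have /andP[? ?] := cb n.
    by rewrite ler_norml; apply/andP; split; lra.
  by rewrite -mulrDl; apply: ler_wpM2r => //; lra.
pose d := b / T - 2 * M.
have d0 : 0 < d by rewrite /d subr_gt0.
have y_mono n s t : s <= t -> d * (t - s) <= y_ n t - y_ n s.
  move=> st; rewrite !yE.
  rewrite [leRHS](_ : _ =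
    c_ n * (t - s) + (double_prim T (u_ n) t - double_prim T (u_ n) s)); last by ring.
  have ts : 0 <= t - s by rewrite subr_ge0.
  have := dl n t s; rewrite (ger0_norm ts) ler_norml => /andP[l1 _].
  have l2 : (b / T - M) * (t - s) <= c_ n * (t - s).
    by apply: ler_wpM2r => //; have /andP[] := cb n.
  have -> : d * (t - s) = (b / T - M) * (t - s) - M * (t - s) by rewrite /d; ring.
  by apply: (le_trans (lerB l2 (lexx _))); rewrite lerD2l.
have y0 n : y_ n 0 = 0 by rewrite yE mulr0 add0r double_prim0.
have [e [z [he yz]]] := lipschitz_subsequence T_gt0 y_lip y0.
have T0 : 0 <= T by exact: ltW.
have z_mono s t : 0 <= s -> s <= t -> t <= T -> d * (t - s) <= z t - z s.
  move=> s0 st tT.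
  have sI : 0 <= s <= T by rewrite s0 (le_trans st).
  have tI : 0 <= t <= T by rewrite tT (le_trans s0).
  apply: (cvgr_to_ge (cvgB (yz t tI) (yz s sI))).
  by near=> n; exact: y_mono.
have z_inj s t : 0 <= s <= T -> 0 <= t <= T -> z s = z t -> s = t.
  move=> /andP[s0 sT] /andP[t0 tT] zst; apply/eqP; apply/negP => /negP.
  rewrite neq_lt => /orP[] st.
    have := z_mono _ _ s0 (ltW st) tT; rewrite zst subrr leNgt => /negP; apply.
    by rewrite mulr_gt0 // subr_gt0.
  have := z_mono _ _ t0 (ltW st) sT; rewrite zst subrr leNgt => /negP; apply.
  by rewrite mulr_gt0 // subr_gt0.
have z0 : z 0 = 0.
  have := yz 0; rewrite lexx T0 => /(_ isT).
  rewrite (_ : (fun n => _) = fun=> 0); last by apply/funext => n; rewrite y0.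
  by move/cvg_lim => <- //; rewrite lim_cst.
have zT : z T = b.
  have := yz T; rewrite lexx T0 => /(_ isT).
  rewrite (_ : (fun n => _) = fun=> b); last by apply/funext => n; rewrite yT.
  by move/cvg_lim => <- //; rewrite lim_cst.
have z_range s : 0 <= s <= T -> 0 <= z s <= b.
  move=> /andP[s0 sT]; have := z_mono 0 s (lexx 0) s0 sT.
  have := z_mono s T s0 sT (lexx T).
  rewrite z0 zT subr0 => h1 h2.
  have h3 : 0 <= d * s by rewrite mulr_ge0 // ltW.
  have h4 : 0 <= d * (T - s) by rewrite mulr_ge0 ?subr_ge0 // ltW.
  by apply/andP; split; lra.
have delay_cvg s : 0 <= s <= T -> y_ (e n) (delay T (e n) s) @[n --> \oo] --> z s.
  move=> sT.
  pose r n := (b / T + 2 * M) * (T * n.+1%:R^-1).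
  have r0 : r n @[n --> \oo] --> 0.
    rewrite -(mulr0 (b / T + 2 * M)); apply: cvgM; first exact: cvg_cst.
    rewrite -(mulr0 T); apply: cvgM; first exact: cvg_cst.
    exact: cvg_harmonic.
  apply: (@squeeze_cvgr _ _ _ _ (fun n => y_ (e n) s - r n) (fun n => y_ (e n) s + r n)).
  - near=> n; rewrite -ler_distlC distrC; apply: (le_trans (y_lip _ _ _)).
    rewrite /r; apply: ler_wpM2l; first lra.
    have h1 : 0 < T / (e n).+1%:R by rewrite divr_gt0.
    apply: (@le_trans _ _ (T / (e n).+1%:R)).
      rewrite /delay; have /andP[s0 _] := sT.
      move: (T / _) h1 => h h1; rewrite ler_norml.
      by case: (leP 0 (s - h)) => h2; apply/andP; split; lra.
    by apply: ler_wpM2l => //; rewrite lef_pV2 ?posrE // ler_nat ltnS.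
  - by rewrite -[X in _ --> X]subr0; apply: cvgB => //; exact: yz.
  - by rewrite -[X in _ --> X]addr0; apply: cvgD => //; exact: yz.
have [N [mN N0 sN]] := @negligible_level_sets z [set s | 0 <= s <= T] z_inj.
(* off N the limit is strictly inside a branch *)
pose D : set Rm := `[0, T]%classic `\` N.
have mD : measurable D by apply: measurableD => //; exact: measurable_itv.
have DP s : D s -> 0 <= s <= T /\ exists2 j, (j <= k)%N & wall a j - 2 * a < z s < wall a j.
  move=> [/=]; rewrite in_itv /= => sT Ns; split => //.
  have /andP[zs0 zsb] := z_range _ sT.
  have [|j jk /andP[zj1 zj2]] := @exists_branch R a a_gt0 k (z s).
    by move: zsb; rewrite /b /wall; have := a_gt0; move=> ? ?; apply/andP; split; lra.
  have nw i : z s != wall a i.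
    by apply/eqP => zi; apply: Ns; apply: sN; split => //; exists i.
  exists j => //; apply/andP; split; last by rewrite lt_neqAle nw zj2.
  rewrite lt_neqAle zj1 andbT.
  case: j jk zj1 zj2 => [|j] jk zj1 zj2.
    by apply/eqP => zE; move: zs0; rewrite -zE /wall; have := a_gt0; lra.
  by rewrite wallS addrK eq_sym.
have u_branch s j : 0 <= s <= T -> (j <= k)%N -> wall a j - 2 * a < z s < wall a j ->
    u_ (e n) s @[n --> \oo] --> (-1) ^+ j * g s (fold a k (z s)).
  by move=> sT jk zj; apply: smoothed_cvg => //; exact: delay_cvg.
pose u : R -> R := (fun s => lim (u_ (e n) s @[n --> \oo])) \_ (D : set R).
have u_lim s : D s -> u_ (e n) s @[n --> \oo] --> u s.
  move=> Ds; rewrite /u patchE mem_set //.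
  have [sT [j jk zj]] := DP s Ds.
  by apply: cvgP; exact: u_branch sT jk zj.
have m0 s : 0 <= m s by exact: le_trans (g_bound s 0).
have du' : dominated m u.
  split.
    apply: (@measurable_fun_cvg _ Rm R setT (fun n => u_ (e n) \_ (D : set R))).
      by move=> n; apply: measurable_patch => //; case: (du (e n)).
    move=> s _; have [Ds|Ds] := pselect (D s).
      rewrite (_ : (fun n => _) = fun n => u_ (e n) s); first exact: u_lim.
      by apply/funext => n; rewrite patchE mem_set.
    rewrite (_ : (fun n => _) = fun n => 0); last first.
      by apply/funext => n; rewrite patchE memNset.
    by rewrite /u patchE memNset //; exact: cvg_cst.
  move=> s; have [Ds|Ds] := pselect (D s); last first.
    by rewrite /u patchE memNset // normr0.
  apply: (cvgr_to_le (cvg_norm (u_lim s Ds))).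
  by near=> n; case: (du (e n)).
have u_ae : {ae mu, forall s : R, 0 <= s <= T -> u_ (e n) s @[n --> \oo] --> u s}.
  exists N; split => // s /=; apply: contra_notP => Ns sT; apply: u_lim.
  by split => //=; rewrite in_itv.
have double_prim_lim t : double_prim T (u_ (e n)) t @[n --> \oo] --> double_prim T u t.
  by apply: (double_prim_cvg m_int) => // n; exact: du.
pose c := (b - double_prim T u T) / T.
have c_lim : c_ (e n) @[n --> \oo] --> c.
  rewrite (_ : (fun n => _) = fun n => (b - double_prim T (u_ (e n)) T) * T^-1).
    by apply: cvgM; [apply: cvgB; [exact: cvg_cst|exact: double_prim_lim]|exact: cvg_cst].
  by apply/funext => n; rewrite -(yT (e n)) yE addrK mulfK // gt_eqF.
have zE t : 0 <= t <= T -> z t = c * t + double_prim T u t.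
  move=> tT; have := yz t tT.
  have : y_ (e n) t @[n --> \oo] --> c * t + double_prim T u t.
    rewrite (_ : (fun n => _) = fun n => c_ (e n) * t + double_prim T (u_ (e n)) t).
      by apply: cvgD => //; apply: cvgM => //; exact: cvg_cst.
    by apply/funext => n; exact: yE.
  by move=> /cvg_lim <- // /cvg_lim <-.
exists u, c; split => //.
- apply: (cvgr_to_ge c_lim); near=> n; by case/andP: (cb (e n)).
- by rewrite -zE // ?lexx ?T0 // zT.
- exists N; split => // s /=; apply: contra_notP => Ns sT j jk.
  rewrite -zE // => zj.
  have Ds : D s by split => //=; rewrite in_itv.
  have /cvg_lim <- // := u_lim s Ds.
  by have /cvg_lim -> := u_branch s j sT jk zj.
Unshelve. all: by end_near. Qed.

End FoldedProblem.

(** * Folding the trajectory back *)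

Section DifferenceQuotient.
Context {R : realType}.

Lemma is_derive_diff_quotient (f : R -> R) (t l : R) :
  diff_quotient f t s @[s --> t^'] --> l -> is_derive t 1 f l.
Proof.
move=> dq.
have H : h^-1 *: (f (h *: 1 + t) - f t) @[h --> 0^'] --> l.
  apply/cvgrPdist_le => e e0.
  have /cvgrPdist_le /(_ e e0) := dq.
  rewrite near_withinE /= => /nbhs_ballP[d d0 Hd].
  rewrite near_withinE /=; apply/nbhs_ballP; exists d => // h.
  rewrite /ball /= sub0r normrN => hd h0.
  have := Hd (h + t); rewrite /ball /= opprD addrCA subrr addr0 normrN => /(_ hd).
  rewrite -subr_eq0 addrK => /(_ h0); rewrite /diff_quotient addrK.
  by rewrite [h%:A]mulr1 mulrC.
by apply: DeriveDef; [apply/cvg_ex; exists l|exact/cvg_lim].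
Qed.

Lemma diff_quotient_affine (F : set_system R) {FF : Filter F} (f y : R -> R)
    (sg b t l : R) : f t = sg * (y t - b) ->
  (\forall s \near F, f s = sg * (y s - b)) ->
  diff_quotient y t s @[s --> F] --> l ->
  diff_quotient f t s @[s --> F] --> sg * l.
Proof.
move=> ft fF dq.
apply: (@cvg_trans _ ((fun s => sg * diff_quotient y t s) @ F)).
  apply: near_eq_cvg; near=> s.
  rewrite /diff_quotient ft (_ : f s = sg * (y s - b)); last by near: s.
  by rewrite mulrA -mulrBr; congr (_ * _ / _); ring.
by apply: cvgM => //; exact: cvg_cst.
Unshelve. all: by end_near. Qed.

End DifferenceQuotient.

(** In this section [y] is a solution of the unfolded problem, [V] its velocity
and [x] the folded motion. *)
Section UnfoldedSolution.
Context {R : realType} (a T : R) (m : R -> R) (g : R -> R -> R) (k : nat).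
Variables (f : R -> R -> R) (u : R -> R) (c : R).
Local Notation Rm := (measurableTypeR R).
Local Notation mu := (@lebesgue_measure R).
Hypothesis a_gt0 : 0 < a.
Hypothesis T_gt0 : 0 < T.
Hypothesis m_int : mu.-integrable (setT : set Rm) (EFin \o m).
Hypothesis gf : {ae mu, forall t : R, 0 <= t <= T -> forall x, g t x = f t x}.

Let b : R := 2 * k%:R * a.
Let speed : R := b / T - 2 * mass T m.
Let y (t : R) : R := c * t + double_prim T u t.

Hypothesis speed_gt0 : 0 < speed.
Hypothesis du : dominated m u.
Hypothesis c_ge : b / T - mass T m <= c.
Hypothesis y_end : y T = b.
Hypothesis u_eq : {ae mu, forall s : R, 0 <= s <= T -> forall j, (j <= k)%N ->
  wall a j - 2 * a < y s < wall a j -> u s = (-1) ^+ j * g s (fold a k (y s))}.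

Let V (t : R) : R := c + prim u t.

Let y_continuous : continuous y.
Proof. exact: (@affine_double_prim_continuous R T m m_int u c du). Qed.

Let V_ge t : 0 <= t <= T -> speed <= V t.
Proof.
move=> tT; have := norm_prim_le m_int du tT.
by rewrite ler_norml /speed /V => /andP[? ?]; have := c_ge; lra.
Qed.

(** Any filter that approaches [t] from within [[0, T]] is allowed: two-sided and
one-sided limits, and limits along an interval, are all needed below. *)
Let y_diff_quotient (F : set_system R) {FF : Filter F} t : 0 <= t <= T ->
  (forall d, 0 < d -> \forall s \near F, [/\ 0 <= s <= T, s != t & `|s - t| < d]) ->
  diff_quotient y t s @[s --> F] --> V t.
Proof.
move=> tT HF; apply/cvgrPdist_le => e e0.
have [d d0 Hd] := double_prim_derivative T m_int du e0.
apply: filterS (HF d d0) => s [sT st std].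
have := Hd t s tT sT std.
have st0 : 0 < `|s - t| by rewrite normr_gt0 subr_eq0.
have st1 : s - t != 0 by rewrite subr_eq0.
rewrite -ler_pdivrMr // -normfV -normrM distrC; congr (`|_| <= _).
by rewrite /diff_quotient /y /V; field.
Qed.

Let y_increasing s t : s < t -> y s < y t.
Proof.
move=> st; have ts : 0 < t - s by rewrite subr_gt0.
have := double_prim_lipschitz T m_int t s du; rewrite (gtr0_norm ts) ler_norml.
move=> /andP[h1 _].
have h2 : (b / T - mass T m) * (t - s) <= c * (t - s).
  by apply: ler_wpM2r => //; exact: ltW.
have h3 : 0 < speed * (t - s) by exact: mulr_gt0.
have h4 : speed * (t - s) = (b / T - mass T m) * (t - s) - mass T m * (t - s).
  by rewrite /speed; ring.
have h5 : y t - y s = c * (t - s) + (double_prim T u t - double_prim T u s).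
  by rewrite /y; ring.
rewrite -subr_gt0 h5; rewrite h4 in h3.
by apply: (lt_le_trans h3); apply: lerD.
Qed.

Let y_start : y 0 = 0.
Proof. by rewrite /y mulr0 add0r double_prim0. Qed.

Let y_range t : 0 <= t <= T -> 0 <= y t <= b.
Proof.
move=> /andP[]; rewrite le_eqVlt => /predU1P[<- _|t0].
  by rewrite y_start lexx !mulr_ge0 // ltW.
rewrite le_eqVlt => /predU1P[->|tT].
  by rewrite y_end lexx !mulr_ge0 // ltW.
by rewrite -y_start -y_end !ltW ?y_increasing.
Qed.

Let y_in t : 0 <= t <= T -> - a < y t < wall a k.
Proof.
move=> /y_range /andP[y1 y2]; move: y2; rewrite /wall /b; have := a_gt0.
by move=> ? ?; apply/andP; split; lra.
Qed.

Let x (t : R) : R := fold a k (y t).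

Let x_continuous : continuous x.
Proof.
move=> t; apply: (@cvg_comp _ _ _ y (fold a k)); first exact: y_continuous.
exact: fold_continuous.
Qed.

Let branch t : 0 <= t <= T -> `|x t| < a ->
  exists2 j, (j <= k)%N & wall a j - 2 * a < y t < wall a j.
Proof.
move=> /y_in /andP[y1 y2]; apply: norm_fold_lt => //.
by rewrite !ltW.
Qed.

Let no_crossing (I : set R) j s t : is_interval I -> I `<=` `[0, T] ->
  (forall r, I r -> `|x r| < a) -> (j <= k)%N ->
  I s -> I t -> y s <= wall a j -> wall a j <= y t -> False.
Proof.
move=> itvI IT xI jk Is It ys yt.
have [st|ts] := leP s t; last first.
  by have := y_increasing ts; rewrite ltNge (le_trans ys yt).
have [||r] := @IVT R y s t (wall a j) st.
- exact: continuous_subspaceT.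
- by rewrite ge_min ys le_max yt orbT.
rewrite in_itv /= => rst yr; have := xI r (itvI _ _ Is It _ rst).
rewrite /x yr fold_wall // normrM normrX normrN1 expr1n mul1r.
by rewrite gtr0_norm // ltxx.
Qed.

(** By the intermediate value theorem [y] cannot pass from one branch to another
without meeting a wall, where [|x| = a]. *)
Let one_branch (I : set R) : is_interval I -> I `<=` `[0, T] ->
  (forall r, I r -> `|x r| < a) -> I !=set0 ->
  exists2 j, (j <= k)%N & forall t, I t -> wall a j - 2 * a < y t < wall a j.
Proof.
move=> itvI IT xI [t0 It0].
have inT t : I t -> 0 <= t <= T by move=> /IT /=; rewrite in_itv.
have [j jk yt0] := branch (inT _ It0) (xI _ It0); exists j => // t It.
have [i ik yt] := branch (inT _ It) (xI _ It).
have wall_le p q : (p < q)%N -> wall a p <= wall a q - 2 * a.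
  case: q => // q; rewrite ltnS wallS addrK => pq.
  by rewrite /wall ler_pM2r // lerD2r ler_pM2l // ler_nat.
have /andP[l0 r0] := yt0; have /andP[l r] := yt.
have [ij|ji|<- //] := ltngtP i j.
- exfalso; apply: (no_crossing itvI IT xI ik It It0); first exact: ltW.
  by rewrite ltW // (le_lt_trans (wall_le _ _ ij)).
- exfalso; apply: (no_crossing itvI IT xI jk It0 It); first exact: ltW.
  by rewrite ltW // (le_lt_trans (wall_le _ _ ji)).
Qed.

Let x_branch j t : (j <= k)%N -> wall a j - 2 * a <= y t <= wall a j ->
  x t = (-1) ^+ j * (y t - 2 * j%:R * a).
Proof. by move=> jk yt; rewrite /x (fold_branch a_gt0 jk). Qed.

Lemma folded_AC (I : set R) : is_interval I -> I `<=` `[0, T] ->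
  (forall t : R, I t -> `|x t| < a) ->
  exists v : R -> R, absolutely_continuous_on I v /\ has_derivative_on I x v.
Proof.
move=> itvI IT xI.
have [I0|nI] := pselect (I !=set0); last first.
  exists (fun=> 0); split.
    move=> e e0; exists 1 => // n p q _ _ _.
    by rewrite big1 // => i _; rewrite subrr normr0.
  by move=> t It; exfalso; apply: nI; exists t.
have [j jk yj] := one_branch itvI IT xI I0.
exists (fun t => (-1) ^+ j * V t); split.
  move=> e e0; have [d d0 Hd] := prim_absolutely_continuous T m_int du e0.
  exists d => // n p q pq tpq sd.
  rewrite (eq_bigr (fun i => `|prim u (q i) - prim u (p i)|)).
    by apply: Hd => // i; have [Ip Iq piqi] := pq i; split => //; exact: IT.
  move=> i _; rewrite -mulrBr normrM normrX normrN1 expr1n mul1r.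
  by rewrite /V (_ : c + _ - _ = prim u (q i) - prim u (p i)) //; ring.
move=> t It.
have inT s : I s -> 0 <= s <= T by move=> /IT /=; rewrite in_itv.
have xE s : I s -> x s = (-1) ^+ j * (y s - 2 * j%:R * a).
  by move=> /yj /andP[l r]; apply: x_branch => //; rewrite !ltW.
apply: (diff_quotient_affine (y := y) (b := 2 * j%:R * a)).
- exact: xE.
- by rewrite near_withinE; apply: filterE => s; exact: xE.
- apply: y_diff_quotient; first exact: inT.
  move=> d d0; rewrite near_withinE near_withinE; near=> s => st Is.
  split; [exact: inT|exact: st|].
  by rewrite distrC; near: s; exact: cvgr_dist_lt.
Unshelve. all: by end_near. Qed.

Let y_diff_interior t : 0 < t < T -> diff_quotient y t s @[s --> t^'] --> V t.
Proof.
move=> /andP[t0 tT]; apply: y_diff_quotient; first by rewrite !ltW.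
move=> d d0; rewrite near_withinE; near=> s => st.
have s0 : 0 < s by near: s; exact: lt_nbhsr.
have sT : s < T by near: s; exact: lt_nbhsl.
split; [by rewrite !ltW|exact: st|].
by rewrite distrC; near: s; exact: cvgr_dist_lt.
Unshelve. all: by end_near. Qed.

Let x_derive1 j t : 0 < t < T -> (j <= k)%N -> wall a j - 2 * a < y t < wall a j ->
  x^`()%classic t = (-1) ^+ j * V t.
Proof.
move=> tT jk /andP[yl yr].
have xt : is_derive t 1 x ((-1) ^+ j * V t).
  apply: is_derive_diff_quotient.
  apply: (diff_quotient_affine (y := y) (b := 2 * j%:R * a)).
  - by apply: x_branch => //; rewrite !ltW.
  - rewrite near_withinE; near=> s => _; apply: x_branch => //.
    apply/andP; split; apply: ltW; near: s.
      exact: (cvgr_gt (y t) (@y_continuous t)).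
    exact: (cvgr_lt (y t) (@y_continuous t)).
  - exact: y_diff_interior.
by rewrite derive1E; case: xt.
Unshelve. all: by end_near. Qed.

Let y_lt_end t : y t < b -> t < T.
Proof.
rewrite -y_end => yt; rewrite ltNge; apply/negP.
rewrite le_eqVlt => /predU1P[Tt|/y_increasing]; first by rewrite Tt ltxx in yt.
by move=> /(lt_trans yt); rewrite ltxx.
Qed.

(** Near [t] the motion stays in one branch [j], so that [x' = (-1)^j V] there and
[x''(t) = (-1)^j u(t)]; the two signs, of the fold and of the unfolded force,
cancel. *)
Lemma folded_ode : {ae mu, forall t : R, 0 <= t <= T -> `|x t| < a ->
  is_derive t 1 x^`()%classic (f t (x t))}.
Proof.
have ends : {ae mu, forall t : R, t != T}.
  exists [set T]; split; [exact: measurable_set1|exact: lebesgue_measure_set1|].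
  by move=> t /= /negP; rewrite negbK => /eqP.
have start : {ae mu, forall t : R, t != 0}.
  exists [set 0]; split; [exact: measurable_set1|exact: lebesgue_measure_set1|].
  by move=> t /= /negP; rewrite negbK => /eqP.
have aeF := ae_filter_ringOfSetsType mu.
have dV := prim_ae_derivative m_int du.
have := @filterI _ _ aeF _ _ dV (@filterI _ _ aeF _ _
  (@filterI _ _ aeF _ _ u_eq gf) (@filterI _ _ aeF _ _ ends start)).
apply: filterS => {dV} t [dV [[ut gft] [tT t0]]] /[dup] tI /andP[t0' tT'] xt.
have {}tT : t < T by rewrite lt_neqAle tT.
have {}t0 : 0 < t by rewrite lt_neqAle eq_sym t0.
have [j jk yt] := branch tI xt; have /andP[yl yr] := yt.
rewrite -(gft tI) /x (_ : g t _ = (-1) ^+ j * u t); last first.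
  by rewrite (ut tI j jk yt) mulrA -expr2 sqrr_sign mul1r.
apply: (@near_eq_is_derive _ _ _ (fun s => (-1) ^+ j * V s)).
  near=> s; symmetry; apply: x_derive1 => //.
    have s0 : 0 < s by near: s; exact: lt_nbhsr.
    have sT : s < T by near: s; exact: lt_nbhsl.
    exact/andP.
  have sl : wall a j - 2 * a < y s.
    by near: s; exact: (cvgr_gt (y t) (@y_continuous t)).
  have sr : y s < wall a j.
    by near: s; exact: (cvgr_lt (y t) (@y_continuous t)).
  exact/andP.
have dVt : is_derive t 1 (cst c + prim u) (0 + u t).
  by apply: is_deriveD; exact: dV.
have := is_deriveZ ((-1) ^+ j) dVt; rewrite add0r.
exact.
Unshelve. all: by end_near. Qed.

(** At the wall [j] the motion passes from the branch [j] to the branch [j + 1];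
there [V] is the two-sided derivative of [y] while the slope of the fold changes
sign. *)
Lemma folded_impulse s : 0 <= s <= T -> `|x s| = a ->
  exists v : R, left_velocity x s v /\ right_velocity x s (- v).
Proof.
move=> sT xs; have [j jk ys] := norm_fold_eq a_gt0 (y_in sT) xs.
have a0 := a_gt0.
have wall0 : 0 < wall a j by rewrite /wall mulr_gt0 // ltr_wpDl // mulr_ge0.
have wallb : wall a j < b.
  have : j%:R + 1 <= k%:R :> R by rewrite natr1 ler_nat.
  rewrite -(ler_pM2r a0) /wall /b => h; lra.
have s0 : 0 < s.
  have /andP[+ _] := sT; rewrite le_eqVlt => /predU1P[s0|//].
  by move: ys; rewrite -s0 y_start => ys; move: wall0; rewrite -ys ltxx.
have s_T : s < T by apply: y_lt_end; rewrite ys.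
exists ((-1) ^+ j * V s); split.
  rewrite /left_velocity.
  apply: (diff_quotient_affine (y := y) (b := 2 * j%:R * a)).
  - by apply: x_branch; [exact: ltnW|rewrite ys; apply/andP; split; lra].
  - near=> r; apply: x_branch; first exact: ltnW.
    apply/andP; split; last first.
      by rewrite -ys ltW // y_increasing //; near: r; exact: nbhs_left_lt.
    apply: ltW; near: r; apply: cvg_within.
    by apply: (cvgr_gt (y s) (@y_continuous s)); rewrite ys; lra.
  - apply: y_diff_quotient => // d d0; near=> r.
    have rs : r < s by near: r; exact: nbhs_left_lt.
    have r0 : 0 < r by near: r; exact: nbhs_left_gt.
    split; [by rewrite (ltW r0) (ltW (lt_trans rs s_T))|by rewrite lt_eqF|].
    by rewrite ltr0_norm ?subr_lt0 // opprB; near: r; exact: nbhs_left_ltBl.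
rewrite /right_velocity -mulNr (_ : - _ = (-1) ^+ j.+1); last by rewrite exprS mulN1r.
apply: (diff_quotient_affine (y := y) (b := 2 * j.+1%:R * a)).
- by apply: x_branch => //; rewrite ys wallS; apply/andP; split; lra.
- near=> r; apply: x_branch => //; rewrite wallS.
  apply/andP; split.
    rewrite addrK -ys ltW // y_increasing //; near: r; exact: nbhs_right_gt.
  apply: ltW; near: r; apply: cvg_within.
  by apply: (cvgr_lt (y s) (@y_continuous s)); rewrite ys; lra.
- apply: y_diff_quotient => // d d0; near=> r.
  have sr : s < r by near: r; exact: nbhs_right_gt.
  have rT : r < T by near: r; exact: nbhs_right_lt.
  split; [by rewrite (ltW rT) (ltW (lt_trans s0 sr))|by rewrite gt_eqF|].
  by rewrite gtr0_norm ?subr_gt0 //; near: r; exact: nbhs_right_ltDr.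
Unshelve. all: by end_near. Qed.

Lemma folded_solution : impulsive_solution a T f x.
Proof.
split.
- exact: continuous_subspaceT.
- move=> t /y_in /andP[yl yr]; rewrite -ler_norml; apply: norm_fold_le => //.
  by rewrite !ltW.
- exact: folded_AC.
- apply: completed_ae; exact: folded_ode.
- exact: folded_impulse.
- rewrite /x y_start; have := @fold_period _ _ a_gt0 k 0 isT.
  by rewrite mulr0 mul0r.
- by rewrite /x y_end fold_period.
Qed.

Lemma folded_initial_velocity : exists2 v, speed <= v & right_velocity x 0 v.
Proof.
have a0 := a_gt0.
have T0 : 0 <= (0 : R) <= T by apply/andP; split; [exact: lexx|exact: ltW].
exists (V 0); first exact: V_ge.
rewrite /right_velocity -[V 0]mul1r.
have wall0 : wall a 0 = a by rewrite /wall; ring.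
apply: (diff_quotient_affine (y := y) (b := 2 * 0%:R * a)).
- by rewrite (@x_branch 0%N) // ?expr0 // y_start wall0; apply/andP; split; lra.
- near=> r; rewrite (@x_branch 0%N) // ?expr0 // wall0.
  apply/andP; split; apply: ltW; near: r; apply: cvg_within.
    by apply: (cvgr_gt (y 0) (@y_continuous 0)); rewrite y_start; lra.
  by apply: (cvgr_lt (y 0) (@y_continuous 0)); rewrite y_start; lra.
- apply: y_diff_quotient => // d d0; near=> r.
  have r0 : 0 < r by near: r; exact: nbhs_right_gt.
  have rT : r < T by near: r; exact: nbhs_right_lt.
  split; [by rewrite !ltW|by rewrite gt_eqF|].
  by rewrite gtr0_norm ?subr0 //; near: r; exact: nbhs_right_lt.
Unshelve. all: by end_near. Qed.

End UnfoldedSolution.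

(** The integer [k] is taken so large that the lower bound [2 k a / T - 2 mass]
for the initial velocity exceeds [K] and is positive. *)
Lemma impulsive_solution_fast {R : realType} (a T : R) (f : R -> R -> R)
    (m : R -> R) : 0 < a -> 0 < T -> caratheodory_fun T f -> L1 T m ->
  (forall t x, 0 <= t <= T -> `|f t x| <= m t) ->
  forall K : R, exists x v,
    [/\ impulsive_solution a T f x, right_velocity x 0 v & K < v].
Proof.
move=> a0 T0 cf mL1 fm K.
have [g [m' [mg cg gm im gf]]] := caratheodory_borel cf mL1 fm.
pose M := mass T m'.
pose k := (Num.truncn ((`|K| + 2 * `|M|) * T / (2 * a))).+1.
have kbig : `|K| + 2 * `|M| < 2 * k%:R * a / T.
  have a2 : 0 < 2 * a by rewrite mulr_gt0.
  rewrite ltr_pdivlMr // (_ : 2 * k%:R * a = k%:R * (2 * a)); last by ring.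
  by rewrite -ltr_pdivrMr // /k truncnS_gt.
have hK := ler_norm K; have hM := ler_norm M; have hK0 := normr_ge0 K.
have fast : 2 * mass T m' < 2 * k%:R * a / T.
  by apply: le_lt_trans kbig; rewrite -/M; lra.
have [u [c [du c_ge y_end u_eq]]] := folded_bvp a0 T0 im mg cg gm fast.
have speed0 : 0 < 2 * k%:R * a / T - 2 * mass T m' by rewrite subr_gt0.
have [v vs rv] := folded_initial_velocity a0 T0 im du c_ge.
exists (fun t => fold a k (c * t + double_prim T u t)), v; split => //.
- exact: (folded_solution a0 im gf speed0 du c_ge y_end u_eq).
- apply: lt_le_trans vs; rewrite -/M ltrBrDr; apply: le_lt_trans kbig; lra.
Qed.

(** * Infinitely many solutions *)

(** The initial velocity of a solution depends only on its restriction to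
[[0, T]]; finitely many solutions would have bounded initial velocities. *)
Theorem theorem3p6 (R : realType) (a T : R) (f : R -> R -> R)
    (m alpha : R -> R) (a_gt0 : 0 < a) (T_gt0 : 0 < T)
    (f_caratheodory : caratheodory_fun T f)
    (m_L1 : L1 T m)
    (f_bounded : forall t x : R, 0 <= t <= T -> `|f t x| <= m t)
    (alpha_L1 : L1 T alpha)
    (f_lipschitz : {ae @completed_lebesgue_measure R, forall t : R, 0 <= t <= T ->
       forall x y : R, `|f t x - f t y| <= alpha t * `|x - y|}) :
  infinite_set [set x \_ `[0, T] | x in [set x | impulsive_solution a T f x]].
Proof.
set S := (X in infinite_set X) => /(@finite_image _ _ _
  (fun w : R -> R => lim (diff_quotient w 0 r @[r --> 0^'+]))).
move=> /finite_seqP[vs vsE].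
have [x [v [xsol xv vbig]]] := impulsive_solution_fast a_gt0 T_gt0
  f_caratheodory m_L1 f_bounded (\big[Order.max/0]_(w <- vs) w).
have : v \in vs.
  suff : [set` vs] v by [].
  rewrite -vsE; exists (x \_ `[0, T]); first by exists x.
  apply: cvg_lim => //; apply: cvg_trans xv; apply: near_eq_cvg; near=> r.
  have r0 : 0 < r by near: r; exact: nbhs_right_gt.
  have rT : r < T by near: r; exact: nbhs_right_lt.
  by rewrite /diff_quotient !patchE !mem_set //= in_itv /= ?lexx !ltW.
move=> vin; move: vbig; rewrite ltNge => /negP; apply.
by apply: (le_bigmax_seq _ v xpredT).
Unshelve. all: by end_near. Qed.
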